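(* For any $q\ge1$, any integers $n,p\ge1$ and any $\sigma,B\ge0$, \[ \frac14\Big[\mathcal{E}^*_{q,\infty}\big(\sigma,B,\tau_q(\sigma,B)\big)+\frac1n\mathcal{M}_q(\sigma,B)\Big]\;\le\;\mathcal{E}_q(\sigma,B)\;\le\;128\Big[\mathcal{E}^*_{q,\infty}\big(\sigma,B,\tau_q(\sigma,B)\big)+\frac1n\mathcal{M}_q(\sigma,B)\Big]. \] Moreover, both inequalities continue to hold when $\mathcal{M}_q(\sigma,B)$ is replaced by $\mathcal{M}_q'(\sigma,B)$.
   Context: For independent random vectors $\boldsymbol{X}_1,\dots,\boldsymbol{X}_n$ in $\mathbb{R}^p$ with joint law $P^n$ and $\mathbb{E}[\boldsymbol{X}_i]=0$, set $\mathcal{V}(P^n)=\max_{j}\frac1n\sum_i\mathbb{E}[X_i(j)^2]$ and $\mathcal{D}_q(P^n)=(\frac1n\sum_i\mathbb{E}[\max_j|X_i(j)|^q])^{1/q}$, and let $\mathcal{E}_q(\sigma,B)$ be the supremum of $\mathbb{E}[\max_{1\le j\le p}|\frac1n\sum_{i=1}^nX_i(j)|]$ over all such laws with $\mathcal{V}(P^n)\le\sigma^2$, $\mathcal{D}_q(P^n)\le B$. Let $\mathcal{P}_q(\sigma,B)$ be the set of distributions $P$ on $\mathbb{R}^p$ with $\mathbb{E}_P[\boldsymbol{X}]=0$, $\max_j\mathbb{E}_P[X(j)^2]\le\sigma^2$, $(\mathbb{E}_P\|\boldsymbol{X}\|_\infty^q)^{1/q}\le B$. Let $\mathcal{P}_{q,\infty}(\sigma,B_q,B_\infty)=\{P\in\mathcal{P}_q(\sigma,B_q):\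 \mathbb{P}_P(\|\boldsymbol{X}\|_\infty>B_\infty)=0\}$ and $\mathcal{E}^*_{q,\infty}(\sigma,B_q,B_\infty)=\sup\{\mathbb{E}_P\|\frac1n\sum_{i=1}^n\boldsymbol{X}_i\|_\infty:\ \boldsymbol{X}_1,\dots,\boldsymbol{X}_n\overset{iid}{\sim}P,\ P\in\mathcal{P}_{q,\infty}(\sigma,B_q,B_\infty)\}$. For a distribution $P$ on $\mathbb{R}^p$ let $T(P;n)=\inf\{t\ge0:\ \mathbb{P}_P(\|\boldsymbol{X}\|_\infty>t)\le 1/(8n)\}$, and define $\tau_q(\sigma,B)=\sup\{T(P;n):P\in\mathcal{P}_q(\sigma,B)\}$, $\mathcal{M}_q(\sigma,B)=\sup\{\mathbb{E}_P[\max_{1\le i\le n}\|\boldsymbol{X}_i\|_\infty]:\ \boldsymbol{X}_i\overset{iid}{\sim}P,\ P\in\mathcal{P}_q(\sigma,B)\}$, and $\mathcal{M}'_q(\sigma,B)=\sup\{\mathbb{E}_P[\max_{1\le i\le n}\|\boldsymbol{X}_i\|_\infty\mathbf{1}\{\|\boldsymbol{X}_i\|_\infty>\tau_q(\sigma,B)\}]:\ \boldsymbol{X}_i\overset{iid}{\sim}P,\ P\in\mathcal{P}_q(\sigma,B)\}$. *)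

(* Defs.v *)
From HB Require Import structures.
From mathcomp Require Import all_boot all_order all_algebra.
From mathcomp Require Import all_classical all_reals all_analysis.
Set Implicit Arguments. Unset Strict Implicit. Unset Printing Implicit Defensive.
Import Order.TTheory GRing.Theory Num.Theory.
Local Open Scope classical_set_scope.
Local Open Scope ring_scope.

Section Defs.
Context {R : realType} {d : measure_display} {T : measurableType d}.
Variable P : probability T R.
Variables n p : nat.

Definition rvec := 'I_p -> T -> R.

Definition normInf (Y : rvec) (x : T) : R := \big[Num.max/0]_(j < p) `|Y j x|.

Definition measurable_rvec (Y : rvec) := forall j, measurable_fun setT (Y j).

(* mutual independence of the random vectors X_1..X_n, stated as the product
   rule on the generating pi-system of measurable rectangles (taking A i j = setT
   for i outside a subfamily gives the product rule for every subfamily) *)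
Definition indep_rvecs (X : 'I_n -> rvec) :=
  forall A : 'I_n -> 'I_p -> set R, (forall i j, measurable (A i j)) ->
    P (\bigcap_(i in [set: 'I_n]) \bigcap_(j in [set: 'I_p]) (X i j @^-1` A i j))
    = (\prod_(i < n) P (\bigcap_(j in [set: 'I_p]) (X i j @^-1` A i j)))%E.

(* equality of the (joint) laws of two random vectors, tested on rectangles,
   which form a pi-system generating the Borel sigma-algebra of R^p *)
Definition same_law (Y Z : rvec) :=
  forall A : 'I_p -> set R, (forall j, measurable (A j)) ->
    P (\bigcap_(j in [set: 'I_p]) (Y j @^-1` A j)) =
    P (\bigcap_(j in [set: 'I_p]) (Z j @^-1` A j)).

Definition iid_rvecs (X : 'I_n -> rvec) :=
  indep_rvecs X /\ forall i i', same_law (X i) (X i').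

Definition centered (Y : rvec) := forall j, ('E_P[Y j] = 0)%E.

Definition Vn (X : 'I_n -> rvec) : \bar R :=
  (\big[maxe/-oo]_(j < p) ((n%:R^-1)%:E * \sum_(i < n) 'E_P[fun x => (X i j x ^+ 2)%R]))%E.

Definition Dn (q : R) (X : 'I_n -> rvec) : \bar R :=
  (((n%:R^-1)%:E * \sum_(i < n) 'E_P[fun x => (normInf (X i) x `^ q)%R]) `^ q^-1)%E.

Definition in_Pq (q sigma B : R) (Y : rvec) :=
  measurable_rvec Y /\ centered Y /\
  (forall j, 'E_P[fun x => (Y j x ^+ 2)%R] <= (sigma ^+ 2)%:E)%E /\
  ('E_P[fun x => (normInf Y x `^ q)%R] `^ q^-1 <= B%:E)%E.

Definition in_Pqinf (q sigma Bq : R) (Binf : \bar R) (Y : rvec) :=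
  in_Pq q sigma Bq Y /\ P [set x | (Binf < (normInf Y x)%:E)%E] = 0%E.

Definition Tquant (Y : rvec) : \bar R :=
  ereal_inf [set t%:E | t in [set t : R | 0 <= t /\
     (P [set x | (t < normInf Y x)%R] <= ((8 * n%:R)^-1)%:E)%E]].

End Defs.

Local Open Scope ereal_scope.

Definition Eq {R : realType} (n p : nat) (q sigma B : R) : \bar R :=
  ereal_sup [set v | exists (d : measure_display) (T : measurableType d)
    (P : probability T R) (X : 'I_n -> @rvec R d T p),
    (forall i, measurable_rvec (X i)) /\ indep_rvecs P X /\
    (forall i, centered P (X i)) /\
    Vn P X <= (sigma ^+ 2)%:E /\ Dn P q X <= B%:E /\
    v = 'E_P[fun x => (\big[Num.max/0]_(j < p)
                        `|n%:R^-1 * \sum_(i < n) X i j x|)%R]].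

Definition tauq {R : realType} (n p : nat) (q sigma B : R) : \bar R :=
  ereal_sup [set v | exists (d : measure_display) (T : measurableType d)
    (P : probability T R) (Y : @rvec R d T p),
    in_Pq P q sigma B Y /\ v = Tquant P n Y].

Definition Estar {R : realType} (n p : nat) (q sigma Bq : R) (Binf : \bar R) : \bar R :=
  ereal_sup [set v | exists (d : measure_display) (T : measurableType d)
    (P : probability T R) (X : 'I_n -> @rvec R d T p),
    iid_rvecs P X /\ (forall i, in_Pqinf P q sigma Bq Binf (X i)) /\
    v = 'E_P[fun x => (\big[Num.max/0]_(j < p)
                        `|n%:R^-1 * \sum_(i < n) X i j x|)%R]].

Definition Mq {R : realType} (n p : nat) (q sigma B : R) : \bar R :=
  ereal_sup [set v | exists (d : measure_display) (T : measurableType d)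
    (P : probability T R) (X : 'I_n -> @rvec R d T p),
    iid_rvecs P X /\ (forall i, in_Pq P q sigma B (X i)) /\
    v = 'E_P[fun x => (\big[Num.max/0]_(i < n) normInf (X i) x)%R]].

Definition Mq' {R : realType} (n p : nat) (q sigma B : R) : \bar R :=
  ereal_sup [set v | exists (d : measure_display) (T : measurableType d)
    (P : probability T R) (X : 'I_n -> @rvec R d T p),
    iid_rvecs P X /\ (forall i, in_Pq P q sigma B (X i)) /\
    v = 'E_P[fun x => (\big[Num.max/0]_(i < n)
          (if (tauq n p q sigma B < (normInf (X i) x)%:E)%E
           then normInf (X i) x else 0))%R]].

(* Main.v *)
Require Import Defs.
From HB Require Import structures.
From mathcomp Require Import all_boot all_order all_algebra.
From mathcomp Require Import all_classical all_reals all_analysis.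
From mathcomp Require Import measurable_realfun ring lra zify.
Import Order.TTheory GRing.Theory Num.Theory numFieldTopology.Exports.

(** Upper bound.  Write [X i = 2 Z i + (remainder)], where [Z i] is half of the
    centered truncation of [X i] at level [tau]; halving keeps [Z i] within the
    moment and sup-norm constraints, and the remainder costs at most
    [2 * \sum_i E |X i| 1(|X i| > tau)].  Let the [Y i] be iid from the average of
    the laws of the [W k] ([W = X] or [W = Z]): this average satisfies the same
    constraints.  As [P(|Y i| > tau) <= 1/(8n)], the sum of the tails is at most
    twice the expectation of their maximum.  Given the labels [f : [n] -> [n]]
    drawn by the [Y i], Jensen's inequality gives
    [E |\sum_i Y i| >= E |\sum_(k in f([n])) W k|]; averaging over [f] and using
    that each label is hit with probability at least 1/2 yields
    [E |\sum_k W k| <= 2 E |\sum_i Y i|].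

    Lower bound.  Pointwise, [|x i|] is at most the average over signs [e] of
    [|\sum_k e k * x k|], and the signed vectors [e k * X k] are still admissible
    for [Eq], whose vectors need not be identically distributed. *)

Set Implicit Arguments. Unset Strict Implicit. Unset Printing Implicit Defensive.
Local Open Scope classical_set_scope.
Local Open Scope ring_scope.

(** * The norm [maxabs] and laws of families of random vectors *)

(** The obstacle is that [Eq] constrains only averages over [i] of laws that may differ, whereas
    [Estar] and [Mq] see a single law; the mixture turns averaged constraints into constraints on
    one law without loss. As [tau] is a supremum over the whole class, it serves every mixture at
    once, and the level 1/(8n) keeps the expected number of other exceedances below 1/8: coinciding
    exceedances cost at most 1/8 of the sum of the tails, which is absorbed. Halving pays for
    recentering: if [U] is the truncated norm and [m] its mean, the recentered norm is at most U +
    m, and by convexity the q-th moment of (U + m)/2 is at most that of [U]. In the upper bound,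
    truncation and the passage to iid vectors each contribute a factor 2, so the constant reached is
    4; in the lower bound each of the two terms is at most [Eq]. Expectations are extended reals,
    and the finiteness needed for subtraction and absorption is drawn from centering: a zero mean
    forces integrability. *)

Section maxabs.
Context {R : realType} {p : nat}.
Implicit Types v w : 'I_p -> R.

(** [normInf Y x] and [maxabs (Y^~ x)] are convertible; the deterministic form is the one that
    truncation and sign changes act on. *)
Definition maxabs v : R := \big[Num.max/0]_(j < p) `|v j|.

Lemma maxabs_ge0 v : 0 <= maxabs v.
Proof. exact: bigmax_ge_id. Qed.

Lemma le_maxabs v j : `|v j| <= maxabs v.
Proof. exact: le_bigmax_cond. Qed.

Lemma maxabs_le v c : 0 <= c -> (forall j, `|v j| <= c) -> maxabs v <= c.
Proof. by move=> c0 vc; apply: bigmax_le. Qed.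

Lemma maxabs_sum (I : Type) (r : seq I) (P : pred I) (F : I -> 'I_p -> R) :
  maxabs (fun j => \sum_(i <- r | P i) F i j) <= \sum_(i <- r | P i) maxabs (F i).
Proof.
apply: maxabs_le => [|j]; first by apply: sumr_ge0 => i _; exact: maxabs_ge0.
by rewrite (le_trans (ler_norm_sum _ _ _))// ler_sum// => i _; exact: le_maxabs.
Qed.

Lemma maxabsZ c v : 0 <= c -> maxabs (fun j => c * v j) = c * maxabs v.
Proof.
move=> c0; apply/eqP; rewrite eq_le; apply/andP; split.
  apply: maxabs_le => [|j]; first by rewrite mulr_ge0 ?maxabs_ge0.
  by rewrite normrM (ger0_norm c0) ler_wpM2l// le_maxabs.
have [->|c_neq0] := eqVneq c 0; first by rewrite mul0r maxabs_ge0.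
have cp : 0 < c by rewrite lt_neqAle eq_sym c_neq0.
rewrite -ler_pdivlMl//; apply: maxabs_le => [|j].
  by rewrite mulr_ge0 ?maxabs_ge0// invr_ge0.
rewrite ler_pdivlMl// -{1}(ger0_norm c0) -normrM.
exact: (le_maxabs (fun j => c * v j)).
Qed.

Lemma maxabs_le_sum v : maxabs v <= \sum_j `|v j|.
Proof.
apply: maxabs_le => [|j]; first exact: sumr_ge0.
by rewrite (bigD1 j)//= lerDl sumr_ge0.
Qed.

End maxabs.

(** * Measurability and joint laws on tuples *)

Section measurability.
Context {R : realType} d (T : measurableType d).

Lemma measurable_bigmaxr (I : Type) (s : seq I) (F : I -> T -> R) (c : R) :
  (forall i, measurable_fun setT (F i)) ->
  measurable_fun setT (fun x => \big[Num.max/c]_(i <- s) F i x).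
Proof.
move=> mF; elim: s => [|i s ih].
  by under eq_fun do rewrite big_nil; exact: measurable_cst.
by under eq_fun do rewrite big_cons; exact: measurable_maxr.
Qed.

Lemma measurable_maxabs p (Y : 'I_p -> T -> R) :
  (forall j, measurable_fun setT (Y j)) ->
  measurable_fun setT (fun x => maxabs (fun j => Y j x)).
Proof.
by move=> mY; apply: measurable_bigmaxr => j; exact: measurableT_comp.
Qed.

Lemma measurable_pre d' (T' : measurableType d') (f : T -> T') A :
  measurable_fun setT f -> measurable A -> measurable (f @^-1` A).
Proof. by move=> mf mA; rewrite -[X in measurable X]setTI; exact: mf. Qed.

(** Joint laws are taken on tuples, which carry the product sigma-algebra. *)
Definition vec p (Y : 'I_p -> T -> R) (x : T) : p.-tuple R :=
  [tuple Y j x | j < p].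

Lemma tnth_vec p (Y : 'I_p -> T -> R) x j : tnth (vec Y x) j = Y j x.
Proof. by rewrite tnth_mktuple. Qed.

Lemma measurable_vec p (Y : 'I_p -> T -> R) :
  (forall j, measurable_fun setT (Y j)) -> measurable_fun setT (vec Y).
Proof.
move=> mY; apply/measurable_fun_tnthP => j; apply: eq_measurable_fun (mY j).
by move=> x _ /=; rewrite tnth_vec.
Qed.

Definition vecs n p (X : 'I_n -> 'I_p -> T -> R) (x : T) : n.-tuple (p.-tuple R) :=
  [tuple vec (X i) x | i < n].

Lemma tnth_vecs n p (X : 'I_n -> 'I_p -> T -> R) x i : tnth (vecs X x) i = vec (X i) x.
Proof. by rewrite tnth_mktuple. Qed.

Lemma measurable_vecs n p (X : 'I_n -> 'I_p -> T -> R) :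
  (forall i j, measurable_fun setT (X i j)) -> measurable_fun setT (vecs X).
Proof.
move=> mX; apply/measurable_fun_tnthP => i.
apply: eq_measurable_fun (measurable_vec (mX i)).
by move=> x _ /=; rewrite tnth_vecs.
Qed.

Lemma measurable_rect n p (X : 'I_n -> 'I_p -> T -> R) (A : 'I_n -> 'I_p -> set R) :
  (forall i j, measurable_fun setT (X i j)) -> (forall i j, measurable (A i j)) ->
  measurable (\bigcap_(i in [set: 'I_n]) \bigcap_(j in [set: 'I_p]) (X i j @^-1` A i j)).
Proof.
move=> mX mA; apply: fin_bigcap_measurable => // i _.
by apply: fin_bigcap_measurable => // j _; exact: measurable_pre.
Qed.

Lemma measurable_rect1 p (Y : 'I_p -> T -> R) (A : 'I_p -> set R) :
  (forall j, measurable_fun setT (Y j)) -> (forall j, measurable (A j)) ->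
  measurable (\bigcap_(j in [set: 'I_p]) (Y j @^-1` A j)).
Proof.
by move=> mY mA; apply: fin_bigcap_measurable => // j _; exact: measurable_pre.
Qed.

End measurability.

Section transfer.
Context {R : realType}.

Definition rectangle n p (A : 'I_n -> 'I_p -> set R) : set (n.-tuple (p.-tuple R)) :=
  [set t | forall i j, A i j (tnth (tnth t i) j)].

Lemma rectangleE n p (A : 'I_n -> 'I_p -> set R) :
  rectangle A = \bigcap_(i in [set: 'I_n]) \bigcap_(j in [set: 'I_p])
    ((fun t : n.-tuple (p.-tuple R) => tnth (tnth t i) j) @^-1` A i j).
Proof.
by apply/seteqP; split => t /= tA; [move=> i _ j _; exact: tA|move=> i j; exact: tA].
Qed.

Lemma measurable_tnth2 n p (i : 'I_n) (j : 'I_p) :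
  measurable_fun setT (fun t : n.-tuple (p.-tuple R) => tnth (tnth t i) j).
Proof.
by apply: (measurableT_comp (measurable_tnth j)); exact: measurable_tnth.
Qed.

(** Rectangles are stable under intersection, contain the whole space and generate the product
    sigma-algebra, so two finite measures that agree on them are equal. *)
Lemma measure_eq_rectangle n p
    (mu nu : {finite_measure set (n.-tuple (p.-tuple R)) -> \bar R}) :
  (forall A : 'I_n -> 'I_p -> set R, (forall i j, measurable (A i j)) ->
    mu (rectangle A) = nu (rectangle A)) ->
  forall B, measurable B -> mu B = nu B.
Proof.
move=> mu_nu B mB.
pose G : set (set (n.-tuple (p.-tuple R))) :=
  [set C | exists2 A : 'I_n -> 'I_p -> set R,
     (forall i j, measurable (A i j)) & C = rectangle A].
have GT : G setT.
  by exists (fun _ _ => setT) => //; apply/seteqP; split.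
apply: (@g_sigma_algebra_measure_unique _ _ _ G _ (fun=> setT)) => //.
- move=> C [A mA ->]; rewrite rectangleE; apply: measurable_rect => //.
  by move=> i j; exact: measurable_tnth2.
- by apply/seteqP; split => // x _; exists 0%N.
- move=> _ _ [A mA ->] [A' mA' ->]; exists (fun i j => A i j `&` A' i j).
    by move=> i j; exact: measurableI.
  apply/seteqP; split => t /=; first by move=> [tA tA'] i j; split.
  by move=> tA; split => i j; have [] := tA i j.
- by move=> _ [A mA ->]; exact: mu_nu.
- by move=> _; rewrite ltey_eq fin_num_measure.
(* Generation: the identity is measurable from the sigma-algebra of rectangles, since the preimage
   of a set under one coordinate is a rectangle whose other sides are full. *)
have mid : @measurable_fun _ _ (g_sigma_algebraType G) (n.-tuple (p.-tuple R)) setT id.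
  apply/(@measurable_fun_tnthP _ _ (g_sigma_algebraType G)) => i.
  apply/(@measurable_fun_tnthP _ _ (g_sigma_algebraType G)) => j _ A mA.
  rewrite setTI; apply: (@sub_sigma_algebra _ setT G).
  exists (fun i' j' => if (i' == i) && (j' == j) then A else setT).
    by move=> i' j'; case: ifP.
  apply/seteqP; split => t /= tA; last by have := tA i j; rewrite !eqxx.
  by move=> i' j'; case: ifP => // /andP[/eqP -> /eqP ->].
by have := mid measurableT _ mB; rewrite setTI.
Qed.

Lemma preimage_rectangle d (T : measurableType d) n p (X : 'I_n -> 'I_p -> T -> R) A :
  vecs X @^-1` rectangle A =
  \bigcap_(i in [set: 'I_n]) \bigcap_(j in [set: 'I_p]) (X i j @^-1` A i j).
Proof.
apply/seteqP; split => x /= xA.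
  by move=> i _ j _ /=; have := xA i j; rewrite tnth_vecs tnth_vec.
by move=> i j; rewrite tnth_vecs tnth_vec; exact: xA.
Qed.

Context d (T : measurableType d) d' (T' : measurableType d').
Variables (P : probability T R) (P' : probability T' R).

Lemma law_eq_rectangle n p (X : 'I_n -> 'I_p -> T -> R) (X' : 'I_n -> 'I_p -> T' -> R) :
  (forall i j, measurable_fun setT (X i j)) ->
  (forall i j, measurable_fun setT (X' i j)) ->
  (forall A : 'I_n -> 'I_p -> set R, (forall i j, measurable (A i j)) ->
    P (\bigcap_(i in [set: 'I_n]) \bigcap_(j in [set: 'I_p]) (X i j @^-1` A i j)) =
    P' (\bigcap_(i in [set: 'I_n]) \bigcap_(j in [set: 'I_p]) (X' i j @^-1` A i j))) ->
  forall B, measurable B -> P (vecs X @^-1` B) = P' (vecs X' @^-1` B).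
Proof.
move=> mX mX' XX' B mB.
pose mv := mfun_Sub (mem_set (measurable_vecs mX)).
pose mv' := mfun_Sub (mem_set (measurable_vecs mX')).
have := @measure_eq_rectangle n p (distribution P mv) (distribution P' mv').
apply => // A mA; change (P (vecs X @^-1` rectangle A) = P' (vecs X' @^-1` rectangle A)).
by rewrite !preimage_rectangle; exact: XX'.
Qed.

End transfer.

(** * Independent copies and averages of laws *)

Section same_law_integral.
Context {R : realType} d (T : measurableType d) d' (T' : measurableType d')
  dE (E : measurableType dE).
Variables (P : probability T R) (P' : probability T' R).

Lemma ge0_integral_same_law (V : T -> E) (V' : T' -> E) (g : E -> \bar R) :
  measurable_fun setT V -> measurable_fun setT V' ->
  (forall B, measurable B -> P (V @^-1` B) = P' (V' @^-1` B)) ->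
  measurable_fun setT g -> (forall e, (0 <= g e)%E) ->
  (\int[P]_x g (V x) = \int[P']_x g (V' x))%E.
Proof.
move=> mV mV' VV' mg g0.
pose V1 := mfun_Sub (mem_set mV); pose V1' := mfun_Sub (mem_set mV').
have <- : (\int[distribution P V1]_y g y = \int[P]_x g (V x))%E.
  exact: ge0_integral_distribution.
have <- : (\int[distribution P' V1']_y g y = \int[P']_x g (V' x))%E.
  exact: ge0_integral_distribution.
by apply: eq_measure_integral => B mB _; exact: VV'.
Qed.

End same_law_integral.

Section copies.
Context {R : realType} d (T : measurableType d) (P : probability T R).

(** Iterated binary products: each induction step puts one more factor [T] in front. *)
Lemma copies n : exists d' (T' : measurableType d') (P' : probability T' R)
    (pi : 'I_n -> T' -> T),
  (forall i, measurable_fun setT (pi i)) /\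
  forall C : 'I_n -> set T, (forall i, measurable (C i)) ->
    P' (\bigcap_(i in [set: 'I_n]) (pi i @^-1` C i)) = (\prod_(i < n) P (C i))%E.
Proof.
elim: n => [|n [d' [T' [P' [pi [mpi piE]]]]]].
  (* With no copies to provide, any probability space will do. *)
  exists d, T, P, (fun _ => id); split=> [i|C mC]; first exact: measurable_id.
  rewrite big_ord0 (_ : \bigcap_(_ in _) _ = setT) ?probability_setT//.
  by apply/seteqP; split => // x _ [].
exists _, (T * T')%type, (P \x P')%E.
exists (fun i => if unlift ord0 i is Some j then pi j \o snd else fst).
split=> [i|C mC].
  by case: unliftP => [j|] _ //; exact: measurableT_comp.
rewrite big_ord_recl -piE//.
rewrite -product_measure1E//; last first.
  by apply: fin_bigcap_measurable => // i _; exact: measurable_pre.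
congr ((P \x P')%E _); apply/seteqP; split => [[x y]/= xyC|[x y]/= [Cx Cy] i _].
  split => [|i _]; first by have := xyC ord0 I; rewrite unlift_none.
  by have := xyC (lift ord0 i) I; rewrite liftK.
by case: unliftP => [j|] -> //=; exact: Cy.
Qed.

Lemma copies_marginal n d' (T' : measurableType d') (P' : probability T' R)
    (pi : 'I_n -> T' -> T) i B :
  (forall C : 'I_n -> set T, (forall i, measurable (C i)) ->
    P' (\bigcap_(i in [set: 'I_n]) (pi i @^-1` C i)) = (\prod_(i < n) P (C i))%E) ->
  measurable B -> P' (pi i @^-1` B) = P B.
Proof.
move=> piE mB; have := piE (fun k => if k == i then B else setT).
rewrite (bigD1 i)//= eqxx big1 ?mule1; last first.
  by move=> k /negbTE ->; rewrite probability_setT.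
move=> <-; last by move=> k; case: ifP.
congr (P' _); apply/seteqP; split => x /=.
  by move=> xB k _; case: eqP => [->|].
by move=> /(_ i I); rewrite eqxx.
Qed.

End copies.

Section average.
Context {R : realType} d (T : measurableType d).

(** The index type is kept general because it is used twice: with ['I_n], for the mixture of the
    vectors, and with the maps from ['I_n] to itself, for the mixture over label assignments. *)
Lemma average_probability (K : finType) (m_ : K -> probability T R) :
  (0 < #|K|)%N -> exists m : probability T R,
  (forall A, m A = (#|K|%:R^-1)%:E * \sum_k m_ k A)%E /\
  forall f : T -> \bar R, measurable_fun setT f -> (forall x, 0 <= f x)%E ->
    (\int[m]_x f x = (#|K|%:R^-1)%:E * \sum_k \int[m_ k]_x f x)%E.
Proof.
move=> K0.
(* Finite sums of measures are indexed by an initial segment of the naturals, so [K] is enumerated;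
   [k0] only fills the positions beyond its cardinal. *)
have k0 : K := enum_val (Ordinal K0).
pose mu i : {measure set T -> \bar R} := m_ (nth k0 (enum K) i).
have c0 : 0 <= (#|K|%:R^-1 : R) by rewrite invr_ge0.
have muE (F : K -> \bar R) : (\sum_(i < #|K|) F (nth k0 (enum K) i) = \sum_k F k)%E.
  rewrite (reindex_onto (@enum_val K predT) (@enum_rank K)); last first.
    by move=> k _; exact: enum_rankK.
  by apply: eq_big => [i|i _]; rewrite ?enum_valK ?eqxx// (enum_val_nth k0).
pose m := mscale (NngNum c0) (msum mu #|K|).
have mE A : m A = ((#|K|%:R^-1)%:E * \sum_k m_ k A)%E.
  by rewrite /m /mscale/= /msum -(muE (fun k => m_ k A)).
have m1 : m setT = 1%E.
  rewrite mE; under eq_bigr do rewrite probability_setT.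
  rewrite sumEFin -EFinM sumr_const mulVf// pnatr_eq0 -lt0n//.
pose mP : probability T R := HB.pack (mscale (NngNum c0) (msum mu #|K|))
  (Measure_isProbability.Build _ _ _ m m1).
exists mP; split => // f mf f0.
have <- : (\int[msum mu #|K|]_x f x = \sum_k \int[m_ k]_x f x)%E.
  by rewrite ge0_integral_measure_sum// -(muE (fun k => \int[m_ k]_x f x)%E).
exact: (@ge0_integral_mscale _ _ _ (msum mu #|K|) _ _ (NngNum c0)).
Qed.

End average.

(** * Independence beyond rectangles *)

Section independence.
Context {R : realType} d (T : measurableType d) (P : probability T R).

(** The vectors [X i] read on independent copies of the sample space have the same rectangle
    probabilities as [X], hence the same joint law, and for them the product rule holds for all
    measurable sets. *)
Lemma indep_rvecs_measurable n p (X : 'I_n -> @rvec R d T p)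
    (B : 'I_n -> set (p.-tuple R)) :
  (forall i, measurable_rvec (X i)) -> indep_rvecs P X ->
  (forall i, measurable (B i)) ->
  P (\bigcap_(i in [set: 'I_n]) (vec (X i) @^-1` B i)) =
  (\prod_(i < n) P (vec (X i) @^-1` B i))%E.
Proof.
move=> mX iX mB.
have [d' [T' [P' [pi [mpi piE]]]]] := copies P n.
pose X' i j := X i j \o pi i.
have mX' i j : measurable_fun setT (X' i j).
  by apply: measurableT_comp => //; exact: mX.
pose C : set (n.-tuple (p.-tuple R)) :=
  \bigcap_(i in [set: 'I_n]) ((fun t => tnth t i) @^-1` B i).
have mC : measurable C.
  apply: fin_bigcap_measurable => // i _; apply: measurable_pre => //.
  exact: measurable_tnth.
have -> : \bigcap_(i in [set: 'I_n]) (vec (X i) @^-1` B i) = vecs X @^-1` C.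
  by apply/seteqP; split => x xB i _; have := xB i I; rewrite /= tnth_vecs.
rewrite (law_eq_rectangle (P' := P') (X' := X'))//; last first.
  move=> A mA; rewrite iX// -piE; last first.
    by move=> i; apply: measurable_rect1 => j; [exact: (mX i j)|exact: mA].
  by [].
rewrite -piE; last by move=> i; apply: measurable_pre => //; exact/measurable_vec/mX.
congr (P' _); apply/seteqP; split => x xB i _; have := xB i I;
  by rewrite /= tnth_vecs.
Qed.

Lemma indep_rvecs_comp n p p' (X : 'I_n -> @rvec R d T p)
    (phi : 'I_n -> 'I_p' -> p.-tuple R -> R) :
  (forall i, measurable_rvec (X i)) -> indep_rvecs P X ->
  (forall i j, measurable_fun setT (phi i j)) ->
  indep_rvecs P (fun i j x => phi i j (vec (X i) x)).
Proof.
move=> mX iX mphi A mA.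
pose B i := \bigcap_(j in [set: 'I_p']) (phi i j @^-1` A i j).
have := @indep_rvecs_measurable _ _ _ B mX iX; apply => i.
by apply: measurable_rect1 => //; exact: mphi.
Qed.

(** The law of the pair is the product of its marginals, by uniqueness of the product measure;
    Tonelli then factors the integral, with infinite values allowed. *)
Lemma indep_rvecs_integralM n p (X : 'I_n -> @rvec R d T p) i i'
    (g h : p.-tuple R -> \bar R) :
  (forall i, measurable_rvec (X i)) -> indep_rvecs P X -> i != i' ->
  measurable_fun setT g -> measurable_fun setT h ->
  (forall v, 0 <= g v)%E -> (forall v, 0 <= h v)%E ->
  (\int[P]_x (g (vec (X i) x) * h (vec (X i') x)) =
   \int[P]_x g (vec (X i) x) * \int[P]_x h (vec (X i') x))%E.
Proof.
move=> mX iX ii' mg mh g0 h0.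
have mv k : measurable_fun setT (vec (X k)) by exact/measurable_vec/mX.
have mpair : measurable_fun setT (fun x => (vec (X i) x, vec (X i') x)).
  exact: measurable_fun_pair.
pose vp k : {mfun T >-> p.-tuple R} := mfun_Sub (mem_set (mv k)).
pose pr : {mfun T >-> (p.-tuple R * p.-tuple R)%type} := mfun_Sub (mem_set mpair).
pose F (z : p.-tuple R * p.-tuple R) := (g z.1 * h z.2)%E.
have mF : measurable_fun setT F.
  by apply: emeasurable_funM; exact: measurableT_comp.
have F0 z : (0 <= F z)%E by rewrite mule_ge0.
transitivity (\int[distribution P pr]_z F z)%E.
  by rewrite ge0_integral_distribution.
transitivity (\int[distribution P (vp i) \x distribution P (vp i')]_z F z)%E.
  apply: eq_measure_integral => A mA _; apply/esym; apply: product_measure_unique => //.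
  move=> B C mB mC.
  pose D k := if k == i then B else if k == i' then C else setT.
  have mD k : measurable (D k) by rewrite /D; case: ifP => // _; case: ifP.
  have := @indep_rvecs_measurable _ _ _ D mX iX mD.
  rewrite (bigD1 i)//= (bigD1 i')/=; last by rewrite eq_sym.
  rewrite big1 ?mule1; last first.
    move=> k /andP[/negbTE ki /negbTE ki'].
    by rewrite /D ki ki' preimage_setT probability_setT.
  rewrite /D eqxx (eq_sym i' i) (negbTE ii') eqxx => <-.
  rewrite /distribution/pushforward; congr (P _).
  apply/seteqP; split => x /=.
    by move=> [xB xC] k _; case: eqP => [->//|_]; case: eqP => [->|].
  move=> xD; split; first by have := xD i I; rewrite eqxx.
  by have := xD i' I; rewrite (eq_sym i' i) (negbTE ii') eqxx.
rewrite fubini_tonelli1// /fubini_F/= /F/=.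
transitivity (\int[distribution P (vp i)]_x (g x * \int[distribution P (vp i')]_y h y))%E.
  by apply: eq_integral => x _; rewrite ge0_integralZl.
rewrite ge0_integralZr//; last exact: integral_ge0.
by rewrite !ge0_integral_distribution.
Qed.

End independence.

Section mixture.
Context {R : realType} d (T : measurableType d) (P : probability T R).

(** The sample space consists of independent copies of the averaged law on [p.-tuple R], so that
    [vec (Y i)] is the projection [pi i] itself. *)
Lemma iid_mixture n p (W : 'I_n -> @rvec R d T p) :
  (0 < n)%N -> (forall k, measurable_rvec (W k)) ->
  exists d' (T' : measurableType d') (P' : probability T' R) (Y : 'I_n -> @rvec R d' T' p),
  [/\ forall i, measurable_rvec (Y i), iid_rvecs P' Y,
     forall i B, measurable B -> (P' (vec (Y i) @^-1` B) =
       (n%:R^-1)%:E * \sum_(k < n) P (vec (W k) @^-1` B))%E &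
     forall i (g : p.-tuple R -> \bar R), measurable_fun setT g ->
       (forall v, 0 <= g v)%E ->
       (\int[P']_x g (vec (Y i) x) =
        (n%:R^-1)%:E * \sum_(k < n) \int[P]_x g (vec (W k) x))%E].
Proof.
move=> n0 mW.
have mv k : measurable_fun setT (vec (W k)) by exact/measurable_vec/mW.
pose vp k : {mfun T >-> p.-tuple R} := mfun_Sub (mem_set (mv k)).
have [|m [mE mI]] := average_probability (fun k : 'I_n => distribution P (vp k)).
  by rewrite card_ord.
rewrite card_ord in mE mI.
have [d' [T' [P' [pi [mpi piE]]]]] := copies m n.
pose Y i j x := tnth (pi i x) j.
have vY i : vec (Y i) = pi i.
  by apply/funext => x; apply: eq_from_tnth => j; rewrite tnth_vec.
have mY i : measurable_rvec (Y i).
  move=> j; apply: (measurableT_comp (measurable_tnth j)); exact: mpi.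
have law i B : measurable B -> P' (pi i @^-1` B) = m B.
  exact: copies_marginal.
have mR (A : 'I_p -> set R) : (forall j, measurable (A j)) ->
    measurable (\bigcap_(j in [set: 'I_p]) (fun t : p.-tuple R => tnth t j) @^-1` A j).
  by move=> mA; apply: measurable_rect1 => // j; exact: measurable_tnth.
exists d', T', P', Y; split=> //.
- split=> [A mA|i i' A mA].
    rewrite -[LHS]/(P' (\bigcap_(i in [set: 'I_n]) (pi i @^-1`
       (\bigcap_(j in [set: 'I_p]) (fun t : p.-tuple R => tnth t j) @^-1` A i j)))).
    rewrite piE; last by move=> i; exact: mR.
    by apply: eq_bigr => i _; rewrite -(law i)//; exact: mR.
  pose RA := \bigcap_(j in [set: 'I_p]) (fun t : p.-tuple R => tnth t j) @^-1` A j.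
  rewrite -[LHS]/(P' (pi i @^-1` RA)) -[RHS]/(P' (pi i' @^-1` RA)).
  by rewrite !law//; exact: mR.
- by move=> i B mB; rewrite vY law// mE.
- move=> i g mg g0; rewrite vY.
  pose pii := mfun_Sub (mem_set (mpi i)).
  transitivity (\int[distribution P' pii]_y g y)%E.
    by rewrite ge0_integral_distribution.
  transitivity (\int[m]_y g y)%E.
    by apply: eq_measure_integral => B mB _; exact: law.
  rewrite mI//; congr (_ * _)%E; apply: eq_bigr => k _.
  by rewrite ge0_integral_distribution.
Qed.

End mixture.

(** * Comparison of sums of independent centered vectors *)

Section centered.
Context {R : realType} d (T : measurableType d) (P : probability T R).

(** The integral is the difference of those of the positive and negative parts. If one of them were
    infinite, the difference would be infinite too (+oo - +oo is -oo), so a zero integral forces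
    both to be finite. *)
Lemma integral0_integrable (f : T -> \bar R) :
  measurable_fun setT f -> (\int[P]_x f x = 0)%E -> P.-integrable setT f.
Proof.
move=> mf; rewrite integralE => f0; apply/integrableP; split => //.
have -> : (\int[P]_x `|f x| = \int[P]_x f^\+ x + \int[P]_x f^\- x)%E.
  rewrite -ge0_integralD//; last 2 first.
  - exact: measurable_funepos.
  - exact: measurable_funeneg.
  by apply: eq_integral => x _; rewrite -/((abse \o f) x) fune_abse.
have : (0 <= \int[P]_x f^\+ x)%E by exact: integral_ge0.
have : (0 <= \int[P]_x f^\- x)%E by exact: integral_ge0.
move: f0; case: (\int[P]_x f^\+ x)%E => [a||]; case: (\int[P]_x f^\- x)%E => [b||]//=.
by move=> _ _ _; rewrite -EFinD ltry.
Qed.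

Lemma centeredP p (Y : @rvec R d T p) j : measurable_rvec Y -> centered P Y ->
  P.-integrable setT (EFin \o Y j) /\ (\int[P]_x (Y j x)%:E = 0)%E.
Proof.
move=> mY /(_ j); rewrite unlock => Y0; split => //.
by apply: integral0_integrable => //; exact/measurable_EFinP/mY.
Qed.

Lemma measurable_rvec_sum (I : Type) (s : seq I) (Q : pred I) p (V : I -> @rvec R d T p) :
  (forall i, measurable_rvec (V i)) ->
  measurable_rvec (fun j x => \sum_(i <- s | Q i) V i j x).
Proof.
move=> mV j; rewrite (_ : (fun _ => _) =
    fun x => \sum_(i <- s) (if Q i then V i j x else 0)); last first.
  by apply/funext => x; rewrite big_mkcond.
by apply: measurable_sum => i; case: (Q i) => //; exact: mV.
Qed.

Lemma centered_sum (I : Type) (s : seq I) (Q : pred I) p (V : I -> @rvec R d T p) :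
  (forall i, measurable_rvec (V i)) -> (forall i, centered P (V i)) ->
  centered P (fun j x => \sum_(i <- s | Q i) V i j x).
Proof.
move=> mV cV j; rewrite unlock; under eq_integral do rewrite -sumEFin.
pose f i x : \bar R := if Q i then (V i j x)%:E else 0%E.
transitivity (\int[P]_x (\sum_(i <- s) f i x))%E.
  by apply: eq_integral => x _; rewrite big_mkcond.
have fP i : P.-integrable setT (f i) /\ (\int[P]_x f i x = 0)%E.
  rewrite /f; case: (Q i); first exact: centeredP.
  by split; [exact: integrable0|rewrite integral0].
rewrite integral_sum//; last by move=> i; have [] := fP i.
by rewrite big1// => i _; have [] := fP i.
Qed.

(* Jensen's inequality for the norm [v |-> maxabs v]. *)
Lemma maxabs_le_integral p (S : @rvec R d T p) (a : 'I_p -> R) :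
  measurable_rvec S -> centered P S ->
  ((maxabs a)%:E <= \int[P]_x (maxabs (fun j => a j + S j x))%:E)%E.
Proof.
move=> mS cS; set I := (\int[P]_x _)%E.
have mM : measurable_fun setT (fun x => maxabs (fun j => a j + S j x)).
  by apply: measurable_maxabs => j; apply: measurable_funD => //; exact: mS.
have I0 : (0 <= I)%E by apply: integral_ge0 => x _; rewrite lee_fin maxabs_ge0.
have aI j : (`|a j|%:E <= I)%E.
  have [iS S0] := centeredP j mS cS.
  have ia : P.-integrable setT (EFin \o cst (a j)).
    exact: finite_measure_integrable_cst.
  (* As [S j] has mean zero, [a j] is the mean of [a j + S j]. *)
  have -> : `|a j|%:E = `|\int[P]_x (a j + S j x)%:E|%E.
    under eq_integral do rewrite EFinD.
    by rewrite integralD//= S0 adde0 integral_cst//= probability_setT mule1.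
  apply: (le_trans (le_abse_integral _ _ _)) => //.
    by apply/measurable_EFinP; apply: measurable_funD => //; exact: mS.
  apply: ge0_le_integral => //.
  - apply: measurableT_comp => //.
    by apply/measurable_EFinP; apply: measurable_funD => //; exact: mS.
  - exact/measurable_EFinP.
  - by move=> x _; rewrite lee_fin (le_maxabs (fun j => a j + S j x)).
move: I0 aI; case: I => [r| |]; [|by move=> *; rewrite leey|by rewrite leeNy_eq].
rewrite !lee_fin => r0 ar; exact: maxabs_le.
Qed.

End centered.

Section comparison.
Context {R : realType} d (T : measurableType d) d' (T' : measurableType d').
Variables (P : probability T R) (P' : probability T' R).

(* The [V i] with [i] in the range of [r] on [D] may be replaced by the
   [W k], [k \in D], on an independent space without changing the joint law;
   integrating out the other ones can only decrease the norm. *)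
Lemma le_integral_maxabs_sum m n p (V : 'I_m -> @rvec R d T p)
    (W : 'I_n -> @rvec R d' T' p) (f : 'I_m -> 'I_n) (r : 'I_n -> 'I_m)
    (D : {set 'I_n}) :
  (forall i, measurable_rvec (V i)) -> (forall k, measurable_rvec (W k)) ->
  indep_rvecs P V -> indep_rvecs P' W -> (forall i, centered P (V i)) ->
  (forall i (A : 'I_p -> set R), (forall j, measurable (A j)) ->
    P (\bigcap_(j in [set: 'I_p]) (V i j @^-1` A j)) =
    P' (\bigcap_(j in [set: 'I_p]) (W (f i) j @^-1` A j))) ->
  (forall k, k \in D -> f (r k) = k) ->
  (\int[P']_y (maxabs (fun j => (\sum_(k in D) W k j y)%R))%:E <=
   \int[P]_x (maxabs (fun j => (\sum_i V i j x)%R))%:E)%E.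
Proof.
move=> mV mW iV iW cV VW fr.
pose F := (r @: D)%SET.
have rD : {in D &, injective r}.
  by move=> k k' kD kD' /(congr1 f); rewrite !fr.
have rF k : k \in D -> r k \in F by move=> kD; exact: imset_f.
have Ff i : i \in F -> f i \in D /\ r (f i) = i.
  by move=> /imsetP[k kD ->]; rewrite fr.
pose V' i j (z : T * T') := if i \in F then W (f i) j z.2 else V i j z.1.
have mV' i j : measurable_fun setT (V' i j).
  rewrite /V'; case: (i \in F); apply: measurableT_comp => //.
    exact: mW.
  exact: mV.
pose g (t : m.-tuple (p.-tuple R)) := (maxabs (fun j => \sum_i tnth (tnth t i) j))%:E.
have mg : measurable_fun setT g.
  apply/measurable_EFinP; apply: measurable_maxabs => j.
  by apply: measurable_sum => i; exact: measurable_tnth2.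
have g0 t : (0 <= g t)%E by rewrite lee_fin maxabs_ge0.
have gE d0 (T0 : measurableType d0) (X : 'I_m -> @rvec R d0 T0 p) x :
    g (vecs X x) = (maxabs (fun j => \sum_i X i j x))%:E.
  congr (maxabs _)%:E; apply/funext => j; apply: eq_bigr => i _.
  by rewrite tnth_vecs tnth_vec.
have -> : (\int[P]_x (maxabs (fun j => (\sum_i V i j x)%R))%:E =
    \int[P \x P']_z (maxabs (fun j => (\sum_i V' i j z)%R))%:E)%E.
  transitivity (\int[P]_x g (vecs V x))%E.
    by apply: eq_integral => x _; rewrite gE.
  transitivity (\int[P \x P']_z g (vecs V' z))%E; last first.
    by apply: eq_integral => x _; rewrite gE.
  apply: ge0_integral_same_law => //.
  - by apply: measurable_vecs => i j; exact: mV.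
  - exact: measurable_vecs.
  - apply: law_eq_rectangle => [i j|//|A mA]; first exact: mV.
    (* A rectangle for [V'] is a product of two rectangles: the constraints with index in [F] move
       along [r] to the labels in [D], the others stay on the first factor. *)
    pose A1 i j := if i \in F then setT else A i j.
    pose A2 k j := if k \in D then A (r k) j else setT.
    have mA1 i j : measurable (A1 i j) by rewrite /A1; case: ifP.
    have mA2 i j : measurable (A2 i j) by rewrite /A2; case: ifP.
    pose S1 := \bigcap_(i in [set: 'I_m]) \bigcap_(j in [set: 'I_p]) (V i j @^-1` A1 i j).
    pose S2 := \bigcap_(k in [set: 'I_n]) \bigcap_(j in [set: 'I_p]) (W k j @^-1` A2 k j).
    have -> : \bigcap_(i in [set: 'I_m]) \bigcap_(j in [set: 'I_p]) (V' i j @^-1` A i j) =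
        S1 `*` S2.
      apply/seteqP; split => [[x y]/= xyA|[x y]/= [xA yA] i _ j _].
        split=> [i _ j _|k _ j _] /=.
          rewrite /A1; case: ifPn => // iF.
          by have := xyA i I j I; rewrite /V' /= (negbTE iF).
        rewrite /A2; case: ifPn => // kD.
        by have := xyA (r k) I j I; rewrite /V'/= rF// fr.
      rewrite /V' /=; case: ifPn => iF.
        by have := yA (f i) I j I; have [fD rfi] := Ff _ iF; rewrite /A2 /= fD rfi.
      by have := xA i I j I; rewrite /A1/= (negbTE iF).
    transitivity (P S1 * P' S2)%E; last first.
      apply/esym; apply: product_measure1E.
        by apply: measurable_rect => // i j; exact: mV.
      by apply: measurable_rect => // k j; exact: mW.
    rewrite !iV// iW// (bigID [in F])/= muleC; congr (_ * _)%E.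
      rewrite [RHS](bigID [in F])/= [X in _ = (X * _)%E]big1 ?mul1e; last first.
        move=> i iF; rewrite /A1 iF (_ : \bigcap_(_ in _) _ = setT) ?probability_setT//.
        by apply/seteqP; split.
      by apply: eq_bigr => i iF; rewrite /A1 (negbTE iF).
    rewrite [RHS](bigID [in D])/= [X in _ = (_ * X)%E]big1 ?mule1; last first.
      move=> k kD; rewrite /A2 (negbTE kD).
      rewrite (_ : \bigcap_(_ in _) _ = setT) ?probability_setT//.
      by apply/seteqP; split.
    rewrite big_imset//=; apply: eq_bigr => k kD.
    by rewrite VW// fr// /A2 kD.
have mg' : measurable_fun setT
    (fun z => (maxabs (fun j => \sum_i V' i j z))%:E).
  apply/measurable_EFinP; apply: measurable_maxabs => j.
  exact: measurable_sum.
rewrite fubini_tonelli2//=; last by move=> z; rewrite lee_fin maxabs_ge0.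
apply: ge0_le_integral => //.
- by move=> y _; rewrite lee_fin maxabs_ge0.
- by apply/measurable_EFinP; apply: measurable_maxabs; exact: measurable_rvec_sum.
- apply: (measurable_fun_fubini_tonelli_G (m1 := P)) => // z; rewrite lee_fin maxabs_ge0//.
move=> y _.
(* For fixed [y] the sum is a constant vector, the part over [D], plus the centered sum over the
   indices outside [F]: Jensen applies in [x]. *)
have mS := measurable_rvec_sum (index_enum 'I_m) (fun i => i \notin F) mV.
have cS := centered_sum (index_enum 'I_m) (fun i => i \notin F) mV cV.
apply: le_trans (maxabs_le_integral (fun j => \sum_(k in D) W k j y) mS cS) _.
rewrite le_eqVlt; apply/orP; left; apply/eqP; apply: eq_integral => x _.
congr (maxabs _)%:E; apply/funext => j.
rewrite [RHS](bigID [in F])/=; congr (_ + _).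
  rewrite big_imset//=; apply: eq_bigr => k kD.
  by rewrite /V' rF// fr.
by apply: eq_bigr => i iF; rewrite /V' (negbTE iF).
Qed.

End comparison.

Lemma card_ffun_missing n (k : 'I_n) :
  #|[predC [pred f : {ffun 'I_n -> 'I_n} | k \in (f @: 'I_n)%SET]]| = (n.-1 ^ n)%N.
Proof.
transitivity #|@ffun_on 'I_n (predC1 k)|.
  apply: eq_card => f; rewrite !inE; apply/idP/ffun_onP => kf.
    by move=> i; rewrite !inE; apply: contra kf => /eqP <-; exact: imset_f.
  by apply/imsetP => -[i _ fik]; have := kf i; rewrite !inE fik eqxx.
by rewrite card_ffun_on cardC1 !card_ord.
Qed.

(** A uniform label map misses [k] with probability (1 - 1/n)^n, which is at most 1/2. *)
Lemma card_ffun_hitting n (k : 'I_n) :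
  (n ^ n <= 2 * #|[pred f : {ffun 'I_n -> 'I_n} | k \in (f @: 'I_n)%SET]|)%N.
Proof.
have : (2 * n.-1 ^ n <= n ^ n)%N.
  case: n k => [[]//|n _] /=.
  (* The first two terms of the binomial expansion; for exponent n+1 they are n^(n+1) and (n+1) n^n,
     each at least n^(n+1). *)
  have h m : (n ^ m.+1 + m.+1 * n ^ m <= n.+1 ^ m.+1)%N.
    elim: m => [|m ih]; first by rewrite !expn1 expn0; lia.
    by rewrite [leqRHS]expnS (leq_trans _ (leq_mul (leqnn n.+1) ih))// !expnS; nia.
  rewrite (leq_trans _ (h n))// mul2n -addnn leq_add2l expnS leq_mul2r.
  by rewrite leqnSn orbT.
have := cardC [pred f : {ffun 'I_n -> 'I_n} | k \in (f @: 'I_n)%SET].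
rewrite card_ffun_missing card_ffun !card_ord.
by move: #|_| (n ^ n)%N (n.-1 ^ n)%N => a b c; lia.
Qed.

Section mixture_sum.
Context {R : realType} d (T : measurableType d) (P : probability T R).
Context d' (T' : measurableType d') (P' : probability T' R).

(** For a fixed label map [f] the labels not drawn are lost; averaging over [f] restores all of them
    with equal weight. The constant 2 is the inverse of the lower bound 1/2 on the probability that
    a label is drawn. *)
Lemma le_integral_maxabs_mixture n p (W : 'I_n -> @rvec R d T p)
    (Y : 'I_n -> @rvec R d' T' p) :
  (0 < n)%N -> (forall k, measurable_rvec (W k)) -> indep_rvecs P W ->
  (forall k, centered P (W k)) ->
  (forall i, measurable_rvec (Y i)) -> indep_rvecs P' Y ->
  (forall i B, measurable B -> (P' (vec (Y i) @^-1` B) =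
       (n%:R^-1)%:E * \sum_(k < n) P (vec (W k) @^-1` B))%E) ->
  (\int[P]_x (maxabs (fun j => (\sum_k W k j x)%R))%:E <=
   2%:E * \int[P']_x (maxabs (fun j => (\sum_i Y i j x)%R))%:E)%E.
Proof.
move=> n0 mW iW cW mY iY YW.
have [d0 [T0 [P0 [pi [mpi piE]]]]] := copies P n.
pose K : finType := {ffun 'I_n -> 'I_n}.
have cardK : #|K| = (n ^ n)%N by rewrite card_ffun !card_ord.
have K0 : (0 < #|K|)%N by rewrite cardK expn_gt0 n0.
pose V (f : K) i j := W (f i) j \o pi i.
have mV f i : measurable_rvec (V f i) by move=> j; apply: measurableT_comp => //; exact: mW.
have mVs f : measurable_fun setT (vecs (V f)).
  by apply: measurable_vecs => i j; exact: mV.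
have mYs : measurable_fun setT (vecs Y) by apply: measurable_vecs => i j; exact: mY.
pose Vf f : {mfun T0 >-> n.-tuple (p.-tuple R)} := mfun_Sub (mem_set (mVs f)).
pose Yf : {mfun T' >-> n.-tuple (p.-tuple R)} := mfun_Sub (mem_set mYs).
pose g (t : n.-tuple (p.-tuple R)) := (maxabs (fun j => \sum_i tnth (tnth t i) j))%:E.
have mg : measurable_fun setT g.
  apply/measurable_EFinP; apply: measurable_maxabs => j.
  by apply: measurable_sum => i; exact: measurable_tnth2.
have g0 t : (0 <= g t)%E by rewrite lee_fin maxabs_ge0.
have gE d1 (T1 : measurableType d1) (X : 'I_n -> @rvec R d1 T1 p) x :
    g (vecs X x) = (maxabs (fun j => \sum_i X i j x))%:E.
  congr (maxabs _)%:E; apply/funext => j; apply: eq_bigr => i _.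
  by rewrite tnth_vecs tnth_vec.
have [m [mE mI]] := average_probability (fun f : K => distribution P0 (Vf f)) K0.
have VfP f (A : 'I_n -> 'I_p -> set R) : (forall i j, measurable (A i j)) ->
    P0 (\bigcap_(i in [set: 'I_n]) \bigcap_(j in [set: 'I_p]) (V f i j @^-1` A i j)) =
    (\prod_i P (\bigcap_(j in [set: 'I_p]) (W (f i) j @^-1` A i j)))%E.
  move=> mA; rewrite -piE// => i.
  by apply: measurable_rect1 => // j; exact: mW.
have VfP1 f i (A : 'I_p -> set R) : (forall j, measurable (A j)) ->
    P0 (\bigcap_(j in [set: 'I_p]) (V f i j @^-1` A j)) =
    P (\bigcap_(j in [set: 'I_p]) (W (f i) j @^-1` A j)).
  move=> mA; rewrite -(copies_marginal i piE)//.
  by apply: measurable_rect1 => // j; exact: mW.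
have iV f : indep_rvecs P0 (V f).
  by move=> A mA; rewrite VfP//; apply: eq_bigr => i _; rewrite VfP1.
(* The joint law of [Y] is the uniform mixture over [f] of the joint laws of the [V f]. *)
have YPE B : measurable B -> distribution P' Yf B = m B.
  apply: measure_eq_rectangle => A mA.
  rewrite -[LHS]/(P' (vecs Y @^-1` rectangle A)) preimage_rectangle iY//.
  apply: etrans (esym (mE _)).
  pose S i := \bigcap_(j in [set: 'I_p]) ((fun v : p.-tuple R => tnth v j) @^-1` A i j).
  have mS i : measurable (S i).
    by apply: measurable_rect1 => // j; exact: measurable_tnth.
  have preS d1 (T1 : measurableType d1) (X : @rvec R d1 T1 p) i :
      vec X @^-1` S i = \bigcap_(j in [set: 'I_p]) (X j @^-1` A i j).
    by apply/seteqP; split => x xA j _; have := xA j I; rewrite /= tnth_vec.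
  pose w i k : R := fine (P (\bigcap_(j in [set: 'I_p]) (W k j @^-1` A i j))).
  have wE i k : P (\bigcap_(j in [set: 'I_p]) (W k j @^-1` A i j)) = (w i k)%:E.
    rewrite fineK// fin_num_measure//.
    by apply: measurable_rect1 => // j; exact: mW.
  transitivity (\prod_(i < n) (n%:R^-1 * \sum_k w i k)%:E)%E.
    apply: eq_bigr => i _; rewrite -preS YW//; under eq_bigr do rewrite preS wE.
    by rewrite sumEFin -EFinM.
  (* A product over [i] of sums over [k] expands into a sum over the maps [f], and the [n] factors
     1/n multiply to 1/#|K|. *)
  transitivity ((#|K|%:R^-1)%:E * \sum_(f : K) (\prod_i w i (f i))%:E)%E; last first.
    congr (_ * _)%E; apply: eq_bigr => f _.
    rewrite -[RHS]/(P0 (vecs (V f) @^-1` rectangle A)) preimage_rectangle VfP//.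
    by rewrite -prodEFin; apply: eq_bigr => i _; rewrite wE.
  rewrite sumEFin -EFinM prodEFin big_split/= bigA_distr_bigA; congr (_ * _)%:E.
  by rewrite prodr_const card_ord exprVn cardK natrX.
have -> : (\int[P']_x (maxabs (fun j => (\sum_i Y i j x)%R))%:E = (#|K|%:R^-1)%:E *
    \sum_(f : K) \int[P0]_x (maxabs (fun j => (\sum_i V f i j x)%R))%:E)%E.
  transitivity (\int[distribution P' Yf]_t g t)%E.
    by rewrite ge0_integral_distribution//; apply: eq_integral => x _; rewrite -gE.
  transitivity (\int[m]_t g t)%E.
    by apply: eq_measure_integral => B mB _; exact: YPE.
  rewrite mI//; congr (_ * _)%E; apply: eq_bigr => f _.
  by rewrite ge0_integral_distribution//; apply: eq_integral => x _; rewrite -gE.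
pose D (f : K) := (f @: 'I_n)%SET.
(* One chosen draw for each label in the range of [f]; the default value [k] is only met outside the
   range. *)
pose r (f : K) k := if [pick i | f i == k] is Some i then i else k.
have fr (f : K) k : k \in D f -> f (r f k) = k.
  rewrite /r => /imsetP[i _ ->]; case: pickP => [i' /eqP//|/(_ i)].
  by rewrite eqxx.
have mWD f : measurable_fun setT (fun x => (maxabs (fun j => \sum_(k in D f) W k j x))%:E).
  by apply/measurable_EFinP; apply: measurable_maxabs; exact: measurable_rvec_sum.
pose I0 := (\int[P]_x (maxabs (fun j => (\sum_k W k j x)%R))%:E)%E.
have I00 : (0 <= I0)%E by apply: integral_ge0 => x _; rewrite lee_fin maxabs_ge0.
apply: (@le_trans _ _ (2%:E * ((#|K|%:R^-1)%:E *
  \sum_(f : K) \int[P]_x (maxabs (fun j => (\sum_(k in D f) W k j x)%R))%:E))%E); last first.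
  rewrite lee_pmul2l//; apply: lee_wpmul2l; first by rewrite lee_fin invr_ge0.
  apply: lee_sum => f _.
  apply: (@le_integral_maxabs_sum _ _ _ _ _ _ _ _ _ _ _ _ f (r f)) => //.
  (* The transfer of integrals holds for nonnegative functions, so the mean is carried over through
     its positive and negative parts. *)
  - move=> i j; rewrite unlock; have [iWj Wj0] := centeredP j (mW (f i)) (cW (f i)).
    rewrite -[RHS]Wj0.
    have law B : measurable B -> P0 (pi i @^-1` B) = P B by exact: copies_marginal.
    pose pii : {mfun T0 >-> T} := mfun_Sub (mem_set (mpi i)).
    have : (\int[distribution P0 pii]_x (W (f i) j x)%:E = \int[P]_x (W (f i) j x)%:E)%E.
      by apply: eq_measure_integral => B mB _; exact: law.
    move=> <-; rewrite [RHS]integralE [LHS]integralE.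
    rewrite !ge0_integral_distribution//; last 2 first.
    + exact/measurable_funeneg/measurable_EFinP/mW.
    + exact/measurable_funepos/measurable_EFinP/mW.
    by congr (_ - _)%E; apply: eq_integral => x _; rewrite /= ?(funeposE, funenegE).
  - by move=> i A mA; exact: VfP1.
  - by move=> k kD; exact: fr.
rewrite -ge0_integral_sum//; last by move=> f x _; rewrite lee_fin maxabs_ge0.
have [k0 _] : exists k : 'I_n, true by exists (Ordinal n0).
pose c k : nat := #|[pred f : K | k \in D f]|.
(* Equality, not just a lower bound, is needed: the common count has to leave the sum over [k]
   inside the norm. *)
have cE k : c k = c k0.
  have cC k' : #|[predC [pred f : K | k' \in D f]]| = (n.-1 ^ n)%N.
    exact: card_ffun_missing.
  have := cardC [pred f : K | k0 \in D f].
  by rewrite -(cardC [pred f : K | k \in D f]) !cC => /addIn.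
apply: (@le_trans _ _ (2%:E * ((#|K|%:R^-1)%:E * ((c k0)%:R%:E * I0)))%E).
  rewrite !muleA -!EFinM -[leLHS]mul1e; apply: lee_wpmul2r => //; rewrite lee_fin.
  have := card_ffun_hitting k0; rewrite -cardK -/(c k0) => h.
  rewrite mulrAC ler_pdivlMr ?ltr0n// mul1r -natrM ler_nat; exact: h.
rewrite lee_pmul2l//; apply: lee_wpmul2l; first by rewrite lee_fin invr_ge0.
rewrite -ge0_integralZl//; last 2 first.
- by apply/measurable_EFinP; apply: measurable_maxabs; exact: measurable_rvec_sum.
- by move=> x _; rewrite lee_fin maxabs_ge0.
apply: ge0_le_integral => //.
- by move=> x _; rewrite mule_ge0// lee_fin maxabs_ge0.
- apply: measurable_funeM; apply/measurable_EFinP; apply: measurable_maxabs.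
  exact: measurable_rvec_sum.
- exact: emeasurable_sum.
(* Pointwise triangle inequality over [f]; after exchanging the sums, each [W k] occurs [c k0]
   times. *)
move=> x _; rewrite sumEFin -EFinM lee_fin -maxabsZ//.
apply: le_trans (maxabs_sum _ _ _).
rewrite le_eqVlt; apply/orP; left; apply/eqP; congr maxabs; apply/funext => j.
rewrite (exchange_big_dep predT)//= mulr_sumr; apply: eq_bigr => k _.
by rewrite sumr_const -(cE k) mulr_natl.
Qed.

End mixture_sum.

(** * Truncation and centering *)

Section powR_convexity.
Context {R : realType}.
Implicit Types q m y : R.

Lemma powRB1M q m : 1 <= q -> 0 <= m -> m `^ (q - 1) * m = m `^ q.
Proof.
move=> q1 m0; have [->|mn0] := eqVneq m 0.
  by rewrite mulr0 powR0// gt_eqF// (lt_le_trans _ q1).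
rewrite -[X in _ * X]powRr1// -powRD ?subrK//.
by rewrite mn0 implybT.
Qed.

(** The tangent to the q-th power at [m], with all terms kept nonnegative so that it can be
    integrated. For q > 1 it is Young's inequality for [y] and m^(q-1) with conjugate exponents q
    and q/(q-1); for q = 1 the second exponent is infinite. *)
Lemma powR_tangent q m y : 1 <= q -> 0 <= m -> 0 <= y ->
  q * m `^ (q - 1) * y <= y `^ q + (q - 1) * m `^ q.
Proof.
move=> q1 m0 y0; have [->|qn1] := eqVneq q 1.
  by rewrite subrr powRr0 mul0r addr0 !mul1r powRr1.
have q1' : 1 < q by rewrite lt_neqAle eq_sym qn1.
have q0 : 0 < q by rewrite (lt_trans _ q1').
have s0 : 0 < q - 1 by rewrite subr_gt0.
have e : q^-1 + (q / (q - 1))^-1 = 1 by field; rewrite !gt_eqF.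
have := conjugate_powR y0 (powR_ge0 m (q - 1)) q0 (divr_gt0 q0 s0) e.
rewrite -powRrM (_ : (q - 1) * (q / (q - 1)) = q); last first.
  by field; rewrite gt_eqF.
rewrite -(ler_pM2l q0) => /le_trans; rewrite mulrAC -mulrA; apply.
by rewrite le_eqVlt; apply/orP; left; apply/eqP; field; rewrite !gt_eqF.
Qed.

(** Sum of the tangent inequalities at the midpoint, taken at its two ends. *)
Lemma powR_midpoint q m y : 1 <= q -> 0 <= m -> 0 <= y ->
  (2^-1 * (y + m)) `^ q <= 2^-1 * (y `^ q + m `^ q).
Proof.
move=> q1 m0 y0; set z := 2^-1 * (y + m).
have z0 : 0 <= z by rewrite mulr_ge0// addr_ge0.
have hy := powR_tangent q1 z0 y0; have hm := powR_tangent q1 z0 m0.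
have zq := powRB1M q1 z0.
have : q * z `^ (q - 1) * y + q * z `^ (q - 1) * m = 2 * q * z `^ q.
  by rewrite -zq /z; field.
by move: (z `^ q) (q * z `^ (q - 1) * y) (q * z `^ (q - 1) * m) hy hm => A B C; lra.
Qed.

End powR_convexity.

Section moments.
Context {R : realType} d (T : measurableType d) (P : probability T R).

Lemma integral_prob_cst (r : R) : (\int[P]_x r%:E = r%:E)%E.
Proof. by rewrite integral_cst//= probability_setT mule1. Qed.

Lemma measurable_EFin_powR (Y : T -> R) q : measurable_fun setT Y ->
  measurable_fun setT (fun x => (Y x `^ q)%:E).
Proof.
move=> mY; apply/measurable_EFinP.
exact: (@measurableT_comp _ _ _ _ _ _ (@powR R ^~ q)).
Qed.

(** Jensen for powers: integrate the tangent inequality at the mean [m]. *)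
Lemma powR_integral_le (Y : T -> R) (m q : R) : 1 <= q ->
  measurable_fun setT Y -> (forall x, 0 <= Y x) -> (\int[P]_x (Y x)%:E = m%:E)%E ->
  ((m `^ q)%:E <= \int[P]_x (Y x `^ q)%:E)%E.
Proof.
move=> q1 mY Y0 Ym.
have m0 : 0 <= m.
  by rewrite -lee_fin -Ym; apply: integral_ge0 => x _; rewrite lee_fin.
have q0 : 0 <= q by rewrite (le_trans _ q1).
have c0 : 0 <= q * m `^ (q - 1) by rewrite mulr_ge0// powR_ge0.
have s0 : 0 <= (q - 1) * m `^ q by rewrite mulr_ge0 ?powR_ge0// subr_ge0.
have : (\int[P]_x ((q * m `^ (q - 1))%:E * (Y x)%:E) <=
        \int[P]_x ((Y x `^ q)%:E + ((q - 1) * m `^ q)%:E))%E.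
  apply: ge0_le_integral => //.
  - by move=> x _; rewrite mule_ge0// lee_fin.
  - exact/measurable_funeM/measurable_EFinP.
  - by apply: emeasurable_funD => //; exact: measurable_EFin_powR.
  - by move=> x _; rewrite -EFinM -EFinD lee_fin powR_tangent.
rewrite ge0_integralZl//; [|exact/measurable_EFinP|by move=> x _; rewrite lee_fin].
rewrite ge0_integralD//; [|by move=> x _; rewrite lee_fin powR_ge0|
   exact: measurable_EFin_powR].
rewrite integral_prob_cst Ym.
have : (0 <= \int[P]_x (Y x `^ q)%:E)%E.
  by apply: integral_ge0 => x _; rewrite lee_fin powR_ge0.
case: (\int[P]_x (Y x `^ q)%:E)%E => [r _| _ _|//]; last by rewrite leey.
rewrite -EFinM -EFinD !lee_fin -mulrA powRB1M//; lra.
Qed.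

(** Convexity bounds the moment of [V] by half of that of [U] plus half of m^q, and m^q is at most
    the moment of [U]. *)
Lemma integral_powR_half (U V : T -> R) (m q : R) : 1 <= q ->
  measurable_fun setT U -> measurable_fun setT V ->
  (forall x, 0 <= U x) -> (forall x, 0 <= V x) -> (\int[P]_x (U x)%:E = m%:E)%E ->
  (forall x, V x <= 2^-1 * (U x + m)) ->
  (\int[P]_x (V x `^ q)%:E <= \int[P]_x (U x `^ q)%:E)%E.
Proof.
move=> q1 mU mV U0 V0 Um VU.
have m0 : 0 <= m.
  by rewrite -lee_fin -Um; apply: integral_ge0 => x _; rewrite lee_fin.
have h0 : (0 : R) <= 2^-1 by rewrite invr_ge0.
have mq := powR_integral_le q1 mU U0 Um.
have Iq0 : (0 <= \int[P]_x (U x `^ q)%:E)%E.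
  by apply: integral_ge0 => x _; rewrite lee_fin powR_ge0.
have mUq := measurable_EFin_powR q mU.
have : (\int[P]_x (V x `^ q)%:E <=
    \int[P]_x ((2^-1)%:E * ((U x `^ q)%:E + (m `^ q)%:E)))%E.
  apply: ge0_le_integral => //.
  - by move=> x _; rewrite lee_fin powR_ge0.
  - exact: measurable_EFin_powR.
  - by apply: measurable_funeM; exact: emeasurable_funD.
  - move=> x _; rewrite -EFinD -EFinM lee_fin.
    apply: le_trans (powR_midpoint q1 m0 (U0 x)).
    by rewrite ge0_ler_powR ?nnegrE ?mulr_ge0 ?addr_ge0// (le_trans _ q1).
rewrite ge0_integralZl//; [|exact: emeasurable_funD|
  by move=> x _; rewrite -EFinD lee_fin addr_ge0// powR_ge0].
rewrite ge0_integralD//; [|by move=> x _; rewrite lee_fin powR_ge0|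
  by move=> x _; rewrite lee_fin powR_ge0].
rewrite integral_prob_cst => /le_trans; apply.
move: Iq0 mq; case: (\int[P]_x (U x `^ q)%:E)%E => [r|_ _|//]; last by rewrite leey.
rewrite -EFinD -EFinM !lee_fin; lra.
Qed.

End moments.

Section truncation.
Context {R : realType} (tau : \bar R) (p : nat).

(** The whole vector is cut as soon as its norm exceeds [tau], not coordinate by coordinate: the
    part removed then has norm exactly [tail]. *)
Definition low (v : 'I_p -> R) (j : 'I_p) : R :=
  if (tau < (maxabs v)%:E)%E then 0 else v j.

(** At [X^~ x] this is, up to conversion, the quantity maximized in [Mq']. *)
Definition tail (v : 'I_p -> R) : R :=
  if (tau < (maxabs v)%:E)%E then maxabs v else 0.

Lemma tail_ge0 v : 0 <= tail v.
Proof. by rewrite /tail; case: ifP => // _; exact: maxabs_ge0. Qed.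

Lemma tail_le v : tail v <= maxabs v.
Proof. by rewrite /tail; case: ifP => // _; exact: maxabs_ge0. Qed.

Lemma low_le v j : `|low v j| <= `|v j|.
Proof. by rewrite /low; case: ifP => // _; rewrite normr0. Qed.

Lemma maxabs_low_le v : maxabs (low v) <= maxabs v.
Proof.
apply: maxabs_le => [|j]; first exact: maxabs_ge0.
exact: le_trans (low_le _ _) (le_maxabs _ _).
Qed.

Lemma low_tail_le v j : `|v j - low v j| <= tail v.
Proof.
rewrite /low /tail; case: ifP => _; first by rewrite subr0 le_maxabs.
by rewrite subrr normr0.
Qed.

Lemma maxabs_low_tau v : (0 <= tau)%E -> ((maxabs (low v))%:E <= tau)%E.
Proof.
move=> tau0; have [h|h] := ltP tau ((maxabs v)%:E).
  rewrite (_ : maxabs _ = 0)//; apply/eqP; rewrite eq_le maxabs_ge0 andbT.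
  by apply: maxabs_le => // j; rewrite /low h normr0.
by apply: le_trans h; rewrite lee_fin maxabs_low_le.
Qed.

Section measurability.
Context d (T : measurableType d) (Y : @rvec R d T p).
Hypothesis mY : measurable_rvec Y.

Lemma measurable_gt_tau : measurable_fun setT
  (fun x => (tau < (maxabs (fun j => Y j x))%:E)%E).
Proof.
apply: measurable_fun_lte => //.
by apply/measurable_EFinP; exact: measurable_maxabs.
Qed.

Lemma measurable_low j : measurable_fun setT (fun x => low (fun j => Y j x) j).
Proof.
by apply: measurable_fun_ifT => //; exact: measurable_gt_tau.
Qed.

Lemma measurable_tail : measurable_fun setT (fun x => tail (fun j => Y j x)).
Proof.
apply: measurable_fun_ifT => //; first exact: measurable_gt_tau.
exact: measurable_maxabs.
Qed.

End measurability.
End truncation.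

Section half_centered.
Context {R : realType} d (T : measurableType d) (P : probability T R).
Context (tau : \bar R) (p : nat).
Implicit Types X : @rvec R d T p.

Definition low_mean X j : R := fine (\int[P]_x (low tau (X^~ x) j)%:E)%E.

Definition half_centered X (j : 'I_p) (x : T) : R :=
  2^-1 * (low tau (X^~ x) j - low_mean X j).

Lemma centered_maxabs_integrable X : measurable_rvec X -> centered P X ->
  P.-integrable setT (fun x => (maxabs (X^~ x))%:E).
Proof.
move=> mX cX.
have iS : P.-integrable setT (fun x => \sum_j (`|X j x|)%:E)%E.
  apply: integrable_sum => // j _.
  by apply: integrable_norm; have [] := centeredP j mX cX.
apply: le_integrable iS => //.
  by apply/measurable_EFinP; exact: measurable_maxabs.
move=> x _; rewrite sumEFin lee_fin (ger0_norm (maxabs_ge0 _)).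
by rewrite ger0_norm ?sumr_ge0// maxabs_le_sum.
Qed.

Section facts.
Variable X : @rvec R d T p.
Hypotheses (mX : measurable_rvec X) (cX : centered P X).

Let iX := centered_maxabs_integrable mX cX.

Lemma low_integrable j : P.-integrable setT (fun x => (low tau (X^~ x) j)%:E).
Proof.
apply: le_integrable iX => //.
  by apply/measurable_EFinP; exact: measurable_low.
move=> x _; rewrite lee_fin (ger0_norm (maxabs_ge0 _)).
exact: le_trans (low_le _ _ _) (le_maxabs _ _).
Qed.

Lemma maxabs_low_integrable :
  P.-integrable setT (fun x => (maxabs (low tau (X^~ x)))%:E).
Proof.
apply: le_integrable iX => //.
  by apply/measurable_EFinP; apply: measurable_maxabs => j; exact: measurable_low.
by move=> x _; rewrite lee_fin !(ger0_norm (maxabs_ge0 _)) maxabs_low_le.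
Qed.

Lemma tail_integrable : P.-integrable setT (fun x => (tail tau (X^~ x))%:E).
Proof.
apply: le_integrable iX => //.
  by apply/measurable_EFinP; exact: measurable_tail.
move=> x _; rewrite lee_fin (ger0_norm (maxabs_ge0 _)).
by rewrite (ger0_norm (tail_ge0 _ _)) tail_le.
Qed.

Lemma low_meanE j : (\int[P]_x (low tau (X^~ x) j)%:E = (low_mean X j)%:E)%E.
Proof. by rewrite fineK//; exact/integrable_fin_num/low_integrable. Qed.

Lemma measurable_half_centered : measurable_rvec (half_centered X).
Proof.
move=> j; apply: measurable_funM => //; apply: measurable_funB => //.
exact: measurable_low.
Qed.

Lemma centered_half_centered : centered P (half_centered X).
Proof.
move=> j; rewrite unlock; under eq_integral do rewrite EFinM EFinB.
have ic : P.-integrable setT (EFin \o cst (low_mean X j)).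
  exact: finite_measure_integrable_cst.
have il := low_integrable j.
rewrite integralZl//; last by apply: integrableB.
by rewrite integralB_EFin// low_meanE integral_prob_cst subee// mule0.
Qed.

Lemma low_mean_le j m : (\int[P]_x (maxabs (low tau (X^~ x)))%:E = m%:E)%E ->
  `|low_mean X j| <= m.
Proof.
move=> mE; rewrite -lee_fin -mE -abse_EFin -low_meanE.
apply: le_trans (le_abse_integral _ _ _) _ => //.
  exact/measurable_int/low_integrable.
apply: ge0_le_integral => //.
- by apply: measurableT_comp => //; exact/measurable_int/low_integrable.
- exact/measurable_int/maxabs_low_integrable.
- by move=> x _; rewrite lee_fin le_maxabs.
Qed.

Lemma half_centered_le_mean m x :
  (\int[P]_x (maxabs (low tau (X^~ x)))%:E = m%:E)%E ->
  maxabs ((half_centered X)^~ x) <= 2^-1 * (maxabs (low tau (X^~ x)) + m).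
Proof.
move=> mE; have m0 : 0 <= m.
  by rewrite -lee_fin -mE; apply: integral_ge0 => y _; rewrite lee_fin maxabs_ge0.
apply: maxabs_le => [|j]; first by rewrite mulr_ge0// addr_ge0// maxabs_ge0.
rewrite normrM ger0_norm// ler_pM2l//.
by rewrite (le_trans (ler_normB _ _))// lerD// ?le_maxabs ?low_mean_le.
Qed.

(** The truncated norm and its mean are both at most [tau], hence so is half of their sum. *)
Lemma half_centered_tau x : (0 <= tau)%E -> ((normInf (half_centered X) x)%:E <= tau)%E.
Proof.
move=> tau0.
have /fineK mE := integrable_fin_num measurableT maxabs_low_integrable.
set m := fine _ in mE.
have mtau : (m%:E <= tau)%E.
  rewrite mE; apply: (@le_trans _ _ (\int[P]_x (fun=> tau) x)%E).
    apply: ge0_le_integral => //.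
    - by move=> y _; rewrite lee_fin maxabs_ge0.
    - exact/measurable_int/maxabs_low_integrable.
    - by move=> y _; exact: maxabs_low_tau.
  by rewrite integral_cst//= probability_setT mule1.
have xtau := maxabs_low_tau (X^~ x) tau0.
have := half_centered_le_mean x (esym mE).
move: mtau xtau; case: (tau) => [t| |]; [|by move=> *; rewrite leey|by rewrite leeNy_eq].
rewrite !lee_fin => mt xt /le_trans; apply.
by move: (maxabs _) xt => a xt; lra.
Qed.

Lemma half_centered_powR q : 1 <= q ->
  (\int[P]_x (normInf (half_centered X) x `^ q)%:E <=
   \int[P]_x (normInf X x `^ q)%:E)%E.
Proof.
move=> q1; have q0 : 0 <= q by rewrite (le_trans _ q1).
have /fineK mE := integrable_fin_num measurableT maxabs_low_integrable.
have ml : measurable_fun setT (fun x => maxabs (low tau (X^~ x))).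
  by apply: measurable_maxabs => j; exact: measurable_low.
apply: (@le_trans _ _ (\int[P]_x (maxabs (low tau (X^~ x)) `^ q)%:E)%E).
  apply: integral_powR_half (esym mE) _ => //.
  - exact/measurable_maxabs/measurable_half_centered.
  - by move=> x; exact: maxabs_ge0.
  - by move=> x; exact: maxabs_ge0.
  - by move=> x; exact: half_centered_le_mean.
apply: ge0_le_integral => //.
- by move=> x _; rewrite lee_fin powR_ge0.
- exact: measurable_EFin_powR.
- by apply: measurable_EFin_powR; exact: measurable_maxabs.
- move=> x _; rewrite lee_fin ge0_ler_powR ?nnegrE ?maxabs_ge0//.
  exact: maxabs_low_le.
Qed.

(** The moment argument with exponent 2 for a single coordinate, [m] being the mean of the absolute
    value of its truncation. *)
Lemma half_centered_sqr j :
  (\int[P]_x (half_centered X j x ^+ 2)%:E <= \int[P]_x (X j x ^+ 2)%:E)%E.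
Proof.
have il : P.-integrable setT (fun x => `|low tau (X^~ x) j|%:E).
  exact: integrable_norm (low_integrable j).
have /fineK mE := integrable_fin_num measurableT il.
set m := fine _ in mE.
have ml : measurable_fun setT (fun x => low tau (X^~ x) j) by exact: measurable_low.
have mml : `|low_mean X j| <= m.
  rewrite -lee_fin mE -abse_EFin -low_meanE.
  by apply: le_abse_integral => //; exact/measurable_EFinP.
have sq (a : R) : a ^+ 2 = `|a| `^ 2%:R by rewrite powR_mulrn// real_normK ?num_real.
apply: (@le_trans _ _ (\int[P]_x (`|low tau (X^~ x) j| `^ 2%:R)%:E)%E).
  under eq_integral do rewrite sq.
  apply: integral_powR_half (esym mE) _ => //.
  - by rewrite ler1n.
  - exact: measurableT_comp.
  - by apply: measurableT_comp => //; exact: measurable_half_centered.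
  - move=> x; rewrite normrM ger0_norm// ler_pM2l//.
    by rewrite (le_trans (ler_normB _ _))// lerD.
apply: ge0_le_integral => //.
- by apply: measurable_EFin_powR; exact: measurableT_comp.
- by apply/measurable_EFinP; apply: measurable_funX; exact: mX.
- by move=> x _; rewrite lee_fin sq ge0_ler_powR ?nnegrE// low_le.
Qed.

(** The difference is the part cut off plus the mean of the truncation. As [X j] is centered, that
    mean is minus the mean of the part cut off, so it is bounded by the mean tail. *)
Lemma sub_half_centered_le j x :
  `|X j x - 2 * half_centered X j x| <=
  tail tau (X^~ x) + fine (\int[P]_x (tail tau (X^~ x))%:E)%E.
Proof.
have -> : X j x - 2 * half_centered X j x =
    (X j x - low tau (X^~ x) j) + low_mean X j.
  by rewrite /half_centered; field.
rewrite (le_trans (ler_normD _ _))// lerD ?low_tail_le//.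
rewrite -lee_fin fineK; last exact/integrable_fin_num/tail_integrable.
have [iXj X0] := centeredP j mX cX.
have il := low_integrable j.
rewrite -abse_EFin -low_meanE -abseN.
have -> : (- (\int[P]_x (low tau (X^~ x) j)%:E) =
    \int[P]_x (X j x - low tau (X^~ x) j)%:E)%E.
  under [RHS]eq_integral do rewrite EFinB.
  by rewrite integralB_EFin// X0 sub0e.
have ms : measurable_fun setT (fun x => X j x - low tau (X^~ x) j).
  by apply: measurable_funB; [exact: mX|exact: measurable_low].
apply: le_trans (le_abse_integral _ _ _) _ => //; first exact/measurable_EFinP.
apply: ge0_le_integral => //.
- by apply: measurableT_comp => //; exact/measurable_EFinP.
- exact/measurable_int/tail_integrable.
- by move=> y _; rewrite lee_fin low_tail_le.
Qed.

End facts.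

(** Each remainder pays its tail twice, once pointwise and once in mean, whence the factor 2 before
    the sum. *)
Lemma le_integral_maxabs_truncation n (X : 'I_n -> @rvec R d T p) :
  (forall i, measurable_rvec (X i)) -> (forall i, centered P (X i)) ->
  (\int[P]_x (maxabs (fun j => (\sum_i X i j x)%R))%:E <=
   2%:E * \int[P]_x (maxabs (fun j => (\sum_i half_centered (X i) j x)%R))%:E +
   2%:E * \sum_i \int[P]_x (tail tau ((X i)^~ x))%:E)%E.
Proof.
move=> mX cX.
pose A i : R := fine (\int[P]_x (tail tau ((X i)^~ x))%:E)%E.
have AE i : (\int[P]_x (tail tau ((X i)^~ x))%:E = (A i)%:E)%E.
  rewrite fineK//; apply: integrable_fin_num => //.
  exact: tail_integrable (mX i) (cX i).
have A0 i : 0 <= A i.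
  by rewrite -lee_fin -AE; apply: integral_ge0 => x _; rewrite lee_fin tail_ge0.
have mt i : measurable_fun setT (fun x => (tail tau ((X i)^~ x))%:E).
  by apply/measurable_EFinP; apply: measurable_tail; exact: mX.
have mH : measurable_fun setT
    (fun x => (maxabs (fun j => \sum_i half_centered (X i) j x))%:E).
  apply/measurable_EFinP; apply: measurable_maxabs.
  by apply: measurable_rvec_sum => i; exact: measurable_half_centered (mX i).
apply: (@le_trans _ _ (\int[P]_x (2%:E *
    (maxabs (fun j => (\sum_i half_centered (X i) j x)%R))%:E +
    \sum_i ((tail tau ((X i)^~ x))%:E + (A i)%:E)))%E).
  apply: ge0_le_integral => //.
  - by move=> x _; rewrite lee_fin maxabs_ge0.
  - by apply/measurable_EFinP; apply: measurable_maxabs; exact: measurable_rvec_sum.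
  - apply: emeasurable_funD; first exact: measurable_funeM.
    by apply: emeasurable_sum => i; apply: emeasurable_funD.
  move=> x _; under eq_bigr do rewrite -EFinD.
  rewrite sumEFin -EFinM -EFinD lee_fin -maxabsZ//.
  apply: maxabs_le => [|j].
    rewrite addr_ge0 ?maxabs_ge0// sumr_ge0// => i _.
    by rewrite addr_ge0// tail_ge0.
  have -> : \sum_i X i j x = 2 * \sum_i half_centered (X i) j x +
      \sum_i (X i j x - 2 * half_centered (X i) j x).
    by rewrite mulr_sumr -big_split/=; apply: eq_bigr => i _; rewrite addrC subrK.
  rewrite (le_trans (ler_normD _ _))// lerD//.
    exact: (le_maxabs (fun j => 2 * \sum_i half_centered (X i) j x)).
  rewrite (le_trans (ler_norm_sum _ _ _))// ler_sum// => i _.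
  exact: sub_half_centered_le (mX i) (cX i) j x.
have t0 i x : (0 <= (tail tau ((X i)^~ x))%:E)%E by rewrite lee_fin tail_ge0.
have tA0 i x : (0 <= (tail tau ((X i)^~ x))%:E + (A i)%:E)%E.
  by rewrite adde_ge0// lee_fin.
rewrite ge0_integralD//; last 4 first.
- by move=> x _; rewrite mule_ge0// lee_fin maxabs_ge0.
- exact: measurable_funeM.
- by move=> x _; apply: sume_ge0.
- by apply: emeasurable_sum => i; apply: emeasurable_funD.
rewrite ge0_integralZl//; last by move=> x _; rewrite lee_fin maxabs_ge0.
rewrite leeD2l// ge0_integral_sum//; last by move=> i; apply: emeasurable_funD.
rewrite ge0_sume_distrr; last by move=> i _; exact: integral_ge0.
apply: lee_sum => i _; rewrite ge0_integralD//; last by move=> x _; rewrite lee_fin.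
by rewrite integral_prob_cst AE -EFinD -EFinM lee_fin mulrDl !mul1r.
Qed.

End half_centered.

(** * The classes of the statement *)

Section mixture_Pq.
Context {R : realType} d (T : measurableType d) (P : probability T R).
Context d' (T' : measurableType d') (P' : probability T' R).

(** A moment of the mixture is the average of the moments of the [W k], which is exactly what the
    constraints of [Eq] bound. *)
Lemma mixture_in_Pq n p (q sigma B : R) (W : 'I_n -> @rvec R d T p) (Y : @rvec R d' T' p) :
  (forall k, measurable_rvec (W k)) -> (forall k, centered P (W k)) ->
  (forall j, (n%:R^-1)%:E * \sum_k \int[P]_x (W k j x ^+ 2)%:E <= (sigma ^+ 2)%:E)%E ->
  (((n%:R^-1)%:E * \sum_k \int[P]_x (normInf (W k) x `^ q)%:E) `^ q^-1 <= B%:E)%E ->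
  measurable_rvec Y ->
  (forall g : p.-tuple R -> \bar R, measurable_fun setT g -> (forall v, 0 <= g v)%E ->
     (\int[P']_x g (vec Y x) = (n%:R^-1)%:E * \sum_k \int[P]_x g (vec (W k) x))%E) ->
  in_Pq P' q sigma B Y.
Proof.
move=> mW cW VW DW mY YW.
have mt j : measurable_fun setT (fun v : p.-tuple R => (tnth v j)%:E).
  by apply/measurable_EFinP; exact: (measurable_tnth j).
have vE d0 (T0 : measurableType d0) (X : @rvec R d0 T0 p) x : tnth (vec X x) = X^~ x.
  by apply/funext => j; rewrite tnth_vec.
split => //; split; [|split].
- move=> j; rewrite unlock integralE.
  pose gp (v : p.-tuple R) := maxe (tnth v j)%:E 0%E.
  pose gn (v : p.-tuple R) := maxe (- (tnth v j)%:E)%E 0%E.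
  have mgp : measurable_fun setT gp.
    by apply: (measurable_maxe (mt j)); exact: measurable_cst.
  have mgn : measurable_fun setT gn.
    apply: measurable_maxe; last exact: measurable_cst.
    by apply/measurable_EFinP; apply: measurableT_comp; last exact: measurable_tnth.
  have gp0 v : (0 <= gp v)%E by rewrite le_max lexx orbT.
  have gn0 v : (0 <= gn v)%E by rewrite le_max lexx orbT.
  have gpE d0 (T0 : measurableType d0) (P0 : probability T0 R) (X : @rvec R d0 T0 p) :
    (\int[P0]_x (fun x => (X j x)%:E)^\+ x = \int[P0]_x gp (vec X x))%E.
    by apply: eq_integral => x _; rewrite funeposE /gp tnth_vec.
  have gnE d0 (T0 : measurableType d0) (P0 : probability T0 R) (X : @rvec R d0 T0 p) :
    (\int[P0]_x (fun x => (X j x)%:E)^\- x = \int[P0]_x gn (vec X x))%E.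
    by apply: eq_integral => x _; rewrite funenegE /gn tnth_vec.
  (* The mixture rule covers nonnegative functions only, so centering is checked on the positive and
     negative parts; they are finite, hence the subtraction is legitimate. *)
  have WE k : (\int[P]_x gp (vec (W k) x) = \int[P]_x gn (vec (W k) x))%E /\
      (\int[P]_x gp (vec (W k) x))%E \is a fin_num.
    have [iW W0] := centeredP j (mW k) (cW k).
    have /fineK pf := integrable_pos_fin_num measurableT iW.
    have /fineK nf := integrable_neg_fin_num measurableT iW.
    rewrite integralE -pf -nf in W0.
    rewrite -gpE -gnE -pf -nf; split => //.
    by move: W0 => [/eqP]; rewrite subr_eq0 => /eqP ->.
  rewrite gpE gnE !YW//.
  under [X in (_ - _ * X)%E]eq_bigr do rewrite -(proj1 (WE _)).
  rewrite subee// fin_numM//.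
  by apply/sum_fin_numP => k _ _; have [] := WE k.
- move=> j; rewrite unlock.
  have := YW (fun v => (tnth v j ^+ 2)%:E).
  under eq_integral do rewrite tnth_vec.
  move=> ->; last 2 first.
  + by apply/measurable_EFinP; apply: measurable_funX; exact: measurable_tnth.
  + by move=> v; rewrite lee_fin sqr_ge0.
  apply: le_trans (VW j); rewrite le_eqVlt; apply/orP; left; apply/eqP.
  congr (_ * _)%E; apply: eq_bigr => k _; apply: eq_integral => x _.
  by rewrite tnth_vec.
- rewrite unlock.
  have := YW (fun v => (maxabs (tnth v) `^ q)%:E).
  under eq_integral do rewrite vE.
  move=> ->; last 2 first.
  + apply: measurable_EFin_powR; apply: measurable_maxabs => j; exact: measurable_tnth.
  + by move=> v; rewrite lee_fin powR_ge0.
  apply: le_trans DW.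
  suff -> : (\sum_k \int[P]_x (maxabs (tnth (vec (W k) x)) `^ q)%:E =
    \sum_k \int[P]_x (normInf (W k) x `^ q)%:E)%E by [].
  by apply: eq_bigr => k _; apply: eq_integral => x _; rewrite vE.
Qed.

End mixture_Pq.

(** * Quantiles and sums of tails *)

Section quantile.
Context {R : realType} d (T : measurableType d) (P : probability T R).

Lemma Tquant_ge0 n p (Y : @rvec R d T p) : (0 <= Tquant P n Y)%E.
Proof. by apply: le_ereal_inf_tmp => _ [t [t0 _] <-]; rewrite lee_fin. Qed.

(** The infimum is attained: exceeding [t] is the increasing union of exceeding t + 1/(k+1), and
    each of these events is contained in the exceedance of an admissible level. *)
Lemma prob_gt_Tquant n p (Y : @rvec R d T p) (tau : \bar R) :
  measurable_rvec Y -> (Tquant P n Y <= tau)%E ->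
  (P [set x | (tau < (normInf Y x)%:E)%E] <= ((8 * n%:R)^-1)%:E)%E.
Proof.
move=> mY; have mN : measurable_fun setT (normInf Y) by exact: measurable_maxabs.
case: tau => [t| |] Qt; last first.
- by have := le_trans (Tquant_ge0 n Y) Qt.
- rewrite (_ : [set x | _] = set0) ?measure0 ?lee_fin ?invr_ge0 ?mulr_ge0//.
  by apply/seteqP; split.
pose F k := [set x | t + k.+1%:R^-1 < normInf Y x].
have mF k : measurable (F k).
  rewrite -[X in measurable X]setTI; apply: measurable_fun_ltr => //.
have -> : [set x | (t%:E < (normInf Y x)%:E)%E] = \bigcup_k F k.
  apply/seteqP; split => x /=; rewrite lte_fin; last first.
    by move=> [k _ /=]; apply: lt_trans; rewrite ltrDl invr_gt0.
  by move=> /ltr_add_invr[k tk]; exists k.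
have ndF : nondecreasing_seq F.
  move=> k l kl; apply/subsetPset => x /=; apply: le_lt_trans.
  by rewrite lerD2l lef_pV2 ?posrE// ler_nat.
have cv := nondecreasing_cvg_mu (mu := P) mF (bigcupT_measurable F mF) ndF.
rewrite -(cvg_lim _ cv)//; apply: lime_le; first by apply/cvg_ex; eexists; exact: cv.
apply: nearW => k /=.
have : (Tquant P n Y < (t + k.+1%:R^-1)%:E)%E.
  by rewrite (le_lt_trans Qt)// lte_fin ltrDl invr_gt0.
move=> /ereal_inf_lt[_ [s [s0 Ps] <-]]; rewrite lte_fin => st.
apply: le_trans Ps; apply: le_measure; rewrite ?inE//.
  by rewrite -[X in measurable X]setTI; apply: measurable_fun_ltr.
by move=> x /=; apply: lt_trans.
Qed.

End quantile.

Section tail_sum.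
Context {R : realType}.

(* Either at most one [a i] is nonzero, and it is the maximum, or each [i] has
   a companion [j != i] with [b j]. *)
Lemma sum_le_max_pairs n (a : 'I_n -> R) (b : 'I_n -> bool) :
  (forall i, 0 <= a i) -> (forall i, ~~ b i -> a i = 0) ->
  \sum_i a i <= \big[Num.max/0]_i a i + \sum_i \sum_(j | j != i) a i * (b j)%:R.
Proof.
move=> a0 ab.
have [/existsP[i /forallP hi]|] := boolP [exists i, [forall j, (j != i) ==> ~~ b j]].
  rewrite (bigD1 i)//= big1 ?addr0; last first.
    by move=> j ji; apply: ab; exact: (implyP (hi j)).
  rewrite -[leLHS]addr0 lerD ?le_bigmax_cond//.
  by apply: sumr_ge0 => k _; apply: sumr_ge0 => j _; rewrite mulr_ge0.
rewrite negb_exists => /forallP h; rewrite -[leLHS]add0r lerD ?bigmax_ge_id//.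
apply: ler_sum => i _; have := h i; rewrite negb_forall => /existsP[j].
rewrite negb_imply negbK => /andP[ji bj].
rewrite (bigD1 j)//= bj mulr1 lerDl.
by apply: sumr_ge0 => k _; rewrite mulr_ge0.
Qed.

Context d (T : measurableType d) (P : probability T R).

(** Integrating [sum_le_max_pairs] and using independence gives S <= M + S/8 for the sum [S] of the
    mean tails. As [S] is finite, S/8 can be absorbed, and 8/7 is at most 2. *)
Lemma sum_integral_tail_le n p (tau : \bar R) (Y : 'I_n -> @rvec R d T p) :
  (0 < n)%N -> (forall i, measurable_rvec (Y i)) -> indep_rvecs P Y ->
  (forall i, centered P (Y i)) ->
  (forall i, P [set x | (tau < (normInf (Y i) x)%:E)%E] <= ((8 * n%:R)^-1)%:E)%E ->
  (\sum_i \int[P]_x (tail tau ((Y i)^~ x))%:E <=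
   2%:E * \int[P]_x (\big[Num.max/0]_i tail tau ((Y i)^~ x))%:E)%E.
Proof.
move=> n0 mY iY cY PY.
pose A i : R := fine (\int[P]_x (tail tau ((Y i)^~ x))%:E)%E.
have AE i : (\int[P]_x (tail tau ((Y i)^~ x))%:E = (A i)%:E)%E.
  rewrite fineK//; apply: integrable_fin_num => //.
  exact: tail_integrable (mY i) (cY i).
have A0 i : 0 <= A i.
  by rewrite -lee_fin -AE; apply: integral_ge0 => x _; rewrite lee_fin tail_ge0.
pose b i x := (tau < (maxabs ((Y i)^~ x))%:E)%E.
have mt i : measurable_fun setT (fun x => tail tau ((Y i)^~ x)).
  by apply: measurable_tail; exact: mY.
have vE (X : @rvec R d T p) x : tnth (vec X x) = X^~ x.
  by apply/funext => j; rewrite tnth_vec.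
have mcoord : measurable_rvec (fun j (v : p.-tuple R) => tnth v j).
  by move=> j; exact: measurable_tnth.
have mbt (I : measurable_fun setT (fun v : p.-tuple R => (tau < (maxabs (tnth v))%:E)%E)) :
    measurable_fun setT (fun v : p.-tuple R => ((tau < (maxabs (tnth v))%:E)%E%:R : R)%:E).
  apply/measurable_EFinP; rewrite (_ : (fun _ => _) =
    (fun v : p.-tuple R => if (tau < (maxabs (tnth v))%:E)%E then 1 else 0)).
    exact: measurable_fun_ifT.
  by apply/funext => v; case: ifP.
have abE i j : i != j ->
    (\int[P]_x (tail tau ((Y i)^~ x) * (b j x)%:R)%:E <= ((8 * n%:R)^-1 * A i)%:E)%E.
  move=> ij.
  have := @indep_rvecs_integralM _ _ _ P n p Y i j
    (fun v => (tail tau (tnth v))%:E)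
    (fun v => ((tau < (maxabs (tnth v))%:E)%E%:R)%:E) mY iY ij.
  under eq_integral do rewrite !vE -EFinM.
  move=> ->; last 4 first.
  - by apply/measurable_EFinP; exact: measurable_tail mcoord.
  - by apply: mbt; exact: measurable_gt_tau mcoord.
  - by move=> v; rewrite lee_fin tail_ge0.
  - by move=> v; rewrite lee_fin.
  under eq_integral do rewrite vE.
  rewrite AE EFinM muleC; apply: lee_wpmul2r; first by rewrite lee_fin.
  apply: le_trans (PY j).
  rewrite -(setIT [set x | _]) -integral_indic//; last first.
    rewrite -[X in measurable X]setTI; apply: (measurable_gt_tau tau (mY j)) => //.
  rewrite le_eqVlt; apply/orP; left; apply/eqP; apply: eq_integral => x _.
  rewrite vE indicE; congr (_%:R)%:E; congr nat_of_bool.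
  by apply/idP/idP; rewrite inE.
have mb i : measurable_fun setT (fun x => (b i x)%:R : R).
  rewrite (_ : (fun _ => _) = (fun x => if b i x then 1 else 0)).
    by apply: measurable_fun_ifT => //; exact: measurable_gt_tau.
  by apply/funext => v; case: ifP.
have mmax : measurable_fun setT (fun x => (\big[Num.max/0]_i tail tau ((Y i)^~ x))%:E).
  by apply/measurable_EFinP; exact: measurable_bigmaxr.
have mab i j : measurable_fun setT (fun x => (tail tau ((Y i)^~ x) * (b j x)%:R)%:E).
  by apply/measurable_EFinP; exact: measurable_funM.
have ab0 i j x : (0 <= (tail tau ((Y i)^~ x) * (b j x)%:R)%:E)%E.
  by rewrite lee_fin mulr_ge0// tail_ge0.
set M := (\int[P]_x (\big[Num.max/0]_i tail tau ((Y i)^~ x))%:E)%E.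
have M0 : (0 <= M)%E by apply: integral_ge0 => x _; rewrite lee_fin bigmax_ge_id.
have key : ((\sum_i A i)%:E <= M + (8^-1 * \sum_i A i)%:E)%E.
  apply: (@le_trans _ _ (\int[P]_x ((\big[Num.max/0]_i tail tau ((Y i)^~ x))%:E +
      \sum_i \sum_(j | j != i) (tail tau ((Y i)^~ x) * (b j x)%:R)%:E))%E).
    rewrite -sumEFin; under eq_bigr do rewrite -AE.
    rewrite -ge0_integral_sum//; last 2 first.
    - by move=> i; exact/measurable_EFinP.
    - by move=> i x _; rewrite lee_fin tail_ge0.
    apply: ge0_le_integral => //.
    - by move=> x _; apply: sume_ge0 => i _; rewrite lee_fin tail_ge0.
    - by apply: emeasurable_sum => i; exact/measurable_EFinP.
    - apply: emeasurable_funD => //; apply: emeasurable_sum => i.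
      under eq_fun do rewrite big_mkcond.
      by apply: emeasurable_sum => j; case: (j != i).
    move=> x _; under [X in (_ <= _ + X)%E]eq_bigr do rewrite sumEFin.
    rewrite !sumEFin -EFinD lee_fin; apply: sum_le_max_pairs => i.
      exact: tail_ge0.
    by rewrite /b /tail => /negbTE ->.
  rewrite ge0_integralD//; last 3 first.
  - by move=> x _; rewrite lee_fin bigmax_ge_id.
  - by move=> x _; apply: sume_ge0 => i _; apply: sume_ge0 => j _.
  - apply: emeasurable_sum => i; under eq_fun do rewrite big_mkcond.
    by apply: emeasurable_sum => j; case: (j != i).
  rewrite leeD2l// ge0_integral_sum//; last 2 first.
  - move=> i; under eq_fun do rewrite big_mkcond.
    by apply: emeasurable_sum => j; case: (j != i).
  - by move=> i x _; apply: sume_ge0.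
  rewrite mulr_sumr -sumEFin; apply: lee_sum => i _.
  under eq_integral do rewrite big_mkcond.
  rewrite ge0_integral_sum//; last 2 first.
  - by move=> j; case: (j != i).
  - by move=> j x _; case: ifP.
  (* The missing diagonal term counts as zero, so there are [n] terms of weight 1/(8n), in total
     1/8. *)
  apply: (@le_trans _ _ (\sum_(j < n) ((8 * n%:R)^-1 * A i)%:E)%E).
    apply: lee_sum => j _; case: (boolP (j != i)) => [ji|_].
      by apply: abE; rewrite eq_sym.
    by rewrite integral0 lee_fin mulr_ge0// invr_ge0 mulr_ge0.
  rewrite sumEFin lee_fin sumr_const card_ord -[leLHS]mulr_natl mulrA invfM.
  by rewrite mulrCA mulfV ?mulr1// pnatr_eq0 -lt0n.
under eq_bigr do rewrite AE.
rewrite sumEFin; move: key M0; case: M => [m| |//]; last first.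
  by move=> _ _; rewrite mulry gtr0_sg// mul1e leey.
rewrite -EFinD -EFinM !lee_fin; lra.
Qed.

End tail_sum.

(** * Averaging over signs *)

Section signs.
Context {R : realType}.

(** Flipping the sign of index [i] changes the signed sum by plus or minus twice [x i], so the two
    norms average to at least that of [x i]; the flip is an involution and permutes the sign
    patterns. *)
Lemma maxabs_le_signs n p (x : 'I_n -> 'I_p -> R) (i : 'I_n) :
  maxabs (x i) <= #|{ffun 'I_n -> bool}|%:R^-1 *
    \sum_(e : {ffun 'I_n -> bool}) maxabs (fun j => \sum_k (-1) ^+ e k * x k j).
Proof.
set N := #|_|; have N0 : 0 < N%:R :> R.
  by rewrite ltr0n /N card_ffun card_bool expn_gt0.
rewrite ler_pdivlMl//.
have flipK : involutive (fun e : {ffun 'I_n -> bool} =>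
    [ffun k => if k == i then ~~ e k else e k]).
  by move=> e; apply/ffunP => k; rewrite !ffunE; case: eqP => //; rewrite negbK.
set flip := (fun e : {ffun 'I_n -> bool} => _) in flipK.
pose s (e : {ffun 'I_n -> bool}) j := \sum_k (-1) ^+ e k * x k j.
have SS : \sum_e maxabs (s e) = \sum_e 2^-1 * (maxabs (s e) + maxabs (s (flip e))).
  rewrite -mulr_sumr big_split/= [X in _ * (X + _)](reindex_inj (inv_inj flipK))/=.
  by rewrite [LHS](reindex_inj (inv_inj flipK))/=; field.
have -> : N%:R * maxabs (x i) = \sum_(e : {ffun 'I_n -> bool}) maxabs (x i).
  by rewrite sumr_const mulr_natl.
rewrite SS; apply: ler_sum => e _.
rewrite ler_pdivlMl// -maxabsZ//.
apply: maxabs_le => [|j]; first by rewrite addr_ge0// maxabs_ge0.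
have -> : 2 * x i j = (-1) ^+ e i * (s e j - s (flip e) j).
  rewrite /s -sumrB (bigD1 i)//= big1 ?addr0; last first.
    by move=> k /negbTE ki; rewrite ffunE ki subrr.
  by rewrite ffunE eqxx; case: (e i) => /=; rewrite ?expr1 ?expr0; ring.
rewrite normrM normrX normrN1 expr1n mul1r (le_trans (ler_normB _ _))// lerD//;
  exact: le_maxabs.
Qed.

End signs.

(** * Bounds between the suprema *)

Section bounds.
Context {R : realType}.

Lemma average_le (K : finType) (F : K -> \bar R) (c : \bar R) :
  (0 < #|K|)%N -> (0 <= c)%E -> (forall k, F k <= c)%E ->
  ((#|K|%:R^-1)%:E * \sum_k F k <= c)%E.
Proof.
move=> K0; case: c => [c| |//] c0 Fc; last by rewrite leey.
apply: (@le_trans _ _ ((#|K|%:R^-1)%:E * \sum_(k : K) c%:E)%E).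
  by apply: lee_wpmul2l; [rewrite lee_fin invr_ge0|exact: lee_sum].
rewrite sumEFin -EFinM lee_fin sumr_const -[X in _ * X]mulr_natl mulKf//.
by rewrite pnatr_eq0 -lt0n.
Qed.

(** Without the root, the q-th moment constraint can be averaged and compared term by term. *)
Lemma poweR_inv_le (E : \bar R) (q B : R) : 0 < q -> (0 <= E)%E -> 0 <= B ->
  (E `^ q^-1 <= B%:E)%E = (E <= (B `^ q)%:E)%E.
Proof.
move=> q0 E0 B0; have q1 : 0 <= q^-1 by rewrite invr_ge0 ltW.
case: E E0 => [r| |//]; last first.
  by move=> _; rewrite poweRyr ?gt_eqF ?invr_gt0.
rewrite lee_fin => r0; rewrite poweR_EFin !lee_fin; apply/idP/idP => h.
  have := ge0_ler_powR (ltW q0) _ _ h; rewrite -powRrM mulVf ?gt_eqF// powRr1//.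
  by apply; rewrite nnegrE// powR_ge0.
have := ge0_ler_powR q1 _ _ h; rewrite -powRrM mulfV ?gt_eqF// powRr1//.
by apply; rewrite nnegrE// powR_ge0.
Qed.

(** [I] is the original sum, [J] its truncated part and [S] the tails; [K] and [M] are their iid
    counterparts, and [E] and [F] the suprema. The two factors 2 multiply to 4. *)
Lemma combine_bounds (c I J S K M E F : \bar R) :
  (0 <= c -> 0 <= K -> 0 <= M -> I <= 2%:E * J + 2%:E * S -> J <= 2%:E * K ->
   S <= 2%:E * M -> c * K <= E -> M <= F -> c * I <= 4%:E * (E + c * F))%E.
Proof.
move=> c0 K0 M0 IJS JK SM KE MF.
apply: (@le_trans _ _ (c * (4%:E * (K + M)))%E).
  apply: lee_wpmul2l => //; apply: le_trans IJS _.
  have -> : (4%:E = 2%:E * 2%:E :> \bar R)%E by rewrite -EFinM -natrM.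
  by rewrite -muleA !ge0_muleDr ?mule_ge0//; apply: leeD; apply: lee_wpmul2l.
rewrite muleCA; apply: lee_wpmul2l => //; rewrite ge0_muleDr//.
by apply: leeD => //; exact: lee_wpmul2l.
Qed.

Context d (T : measurableType d) (P : probability T R).

Lemma expectation_mean n p (X : 'I_n -> @rvec R d T p) :
  (forall i, measurable_rvec (X i)) ->
  ('E_P[fun x => (\big[Num.max/0]_(j < p) `|n%:R^-1 * \sum_(i < n) X i j x|)%R] =
  (n%:R^-1)%:E * \int[P]_x (maxabs (fun j => (\sum_i X i j x)%R))%:E)%E.
Proof.
move=> mX; rewrite unlock -ge0_integralZl//; last 2 first.
- by apply/measurable_EFinP; apply: measurable_maxabs; exact: measurable_rvec_sum.
- by move=> x _; rewrite lee_fin maxabs_ge0.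
by apply: eq_integral => x _; rewrite -EFinM -maxabsZ// invr_ge0.
Qed.

Lemma signed_mean_le_Eq n p (q sigma B : R) (X : 'I_n -> @rvec R d T p) (e : 'I_n -> bool) :
  (0 < n)%N -> 1 <= q -> 0 <= B ->
  indep_rvecs P X -> (forall i, in_Pq P q sigma B (X i)) ->
  ((n%:R^-1)%:E * \int[P]_x (maxabs (fun j => (\sum_i (-1) ^+ e i * X i j x)%R))%:E <=
   Eq n p q sigma B)%E.
Proof.
move=> n0 q1 B0 iX XP; have q0 : 0 < q by rewrite (lt_le_trans _ q1).
have K0 : (0 < #|'I_n|)%N by rewrite card_ord.
have mX i : measurable_rvec (X i) by have [] := XP i.
have cX i : centered P (X i) by have [_ []] := XP i.
pose X' i j x := (-1) ^+ e i * X i j x.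
have mX' i : measurable_rvec (X' i).
  by move=> j; apply: measurable_funM => //; exact: mX.
have normX' i : normInf (X' i) = normInf (X i).
  apply/funext => x; rewrite /normInf; apply: eq_bigr => j _.
  by rewrite /X' normrM normrX normrN1 expr1n mul1r.
apply: ereal_sup_ubound; exists d, T, P, X'.
split => //; split; [|split; [|split; [|split]]].
- pose phi i j (v : p.-tuple R) := (-1) ^+ e i * tnth v j.
  have -> : X' = fun i j x => phi i j (vec (X i) x).
    by apply/funext => i; apply/funext => j; apply/funext => x; rewrite /phi tnth_vec.
  apply: indep_rvecs_comp => // i j; apply: measurable_funM => //.
  exact: measurable_tnth.
- move=> i j; rewrite unlock; have [iXj Xj0] := centeredP j (mX i) (cX i).
  by under eq_integral do rewrite EFinM; rewrite integralZl// Xj0 mule0.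
- apply: bigmax_le => [|j _]; first by rewrite leNye.
  rewrite -{1}(card_ord n); apply: average_le; rewrite ?lee_fin ?sqr_ge0// => i.
  have [_ [_ [h _]]] := XP i; apply: le_trans (h j).
  rewrite unlock le_eqVlt; apply/orP; left; apply/eqP; apply: eq_integral => x _.
  by rewrite /X' exprMn sqrr_sign mul1r.
- have E0 i : (0 <= 'E_P[fun x => (normInf (X' i) x `^ q)%R])%E.
    by apply: expectation_ge0 => x; exact: powR_ge0.
  rewrite /Dn poweR_inv_le//; last first.
    by apply: mule_ge0; [rewrite lee_fin invr_ge0|exact: sume_ge0].
  rewrite -{1}(card_ord n); apply: average_le; rewrite ?lee_fin ?powR_ge0// => i.
  rewrite -poweR_inv_le// normX'.
  by have [_ [_ []]] := XP i.
- by rewrite expectation_mean.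
Qed.

End bounds.

Section comparisons.
Context {R : realType} (n p : nat) (q sigma B : R).
Hypotheses (q1 : 1 <= q) (n0 : (0 < n)%N) (B0 : 0 <= B).

Lemma Estar_le_Eq tau : (Estar n p q sigma B tau <= Eq n p q sigma B)%E.
Proof.
apply: ge_ereal_sup => _ [d [T [P [X [[iX _] [XP ->]]]]]].
have XP' i : in_Pq P q sigma B (X i) by have [] := XP i.
have mX i : measurable_rvec (X i) by have [] := XP' i.
rewrite expectation_mean//.
apply: le_trans (signed_mean_le_Eq (fun=> false) n0 q1 B0 iX XP').
under [X in (_ <= _ * X)%E]eq_integral do
  under eq_fun do under eq_bigr do rewrite expr0 mul1r.
by [].
Qed.

Lemma Mq_le_Eq : ((n%:R^-1)%:E * Mq n p q sigma B <= Eq n p q sigma B)%E.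
Proof.
have nR : (0 < n%:R :> R) by rewrite ltr0n.
rewrite lee_pdivrMl//; apply: ge_ereal_sup => _ [d [T [P [X [[iX _] [XP ->]]]]]].
have mX i : measurable_rvec (X i) by have [] := XP i.
pose K : finType := {ffun 'I_n -> bool}.
have K0 : (0 < #|K|)%N by rewrite card_ffun card_bool expn_gt0.
pose G (e : K) x := (maxabs (fun j => (\sum_i (-1) ^+ e i * X i j x)%R))%:E.
have mG e : measurable_fun setT (G e).
  apply/measurable_EFinP; apply: measurable_maxabs; apply: measurable_rvec_sum => i j.
  by apply: measurable_funM => //; exact: mX.
have G0 e x : (0 <= G e x)%E by rewrite lee_fin maxabs_ge0.
have GE e : (\int[P]_x G e x <= n%:R%:E * Eq n p q sigma B)%E.
  by rewrite -lee_pdivrMl//; exact: signed_mean_le_Eq.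
(* A signed family belongs to the class of [Eq], which excludes the value -oo. *)
have E0 : (0 <= n%:R%:E * Eq n p q sigma B)%E.
  by apply: le_trans (GE [ffun=> false]); exact: integral_ge0.
apply: le_trans (average_le K0 E0 GE).
rewrite unlock -ge0_integral_sum// -ge0_integralZl//; last 2 first.
- exact: emeasurable_sum.
- by move=> x _; exact: sume_ge0.
apply: ge0_le_integral => //.
- by move=> x _; rewrite lee_fin bigmax_ge_id.
- apply/measurable_EFinP; apply: measurable_bigmaxr => i.
  by apply: measurable_maxabs; exact: mX.
- by apply: measurable_funeM; exact: emeasurable_sum.
move=> x _; rewrite sumEFin -EFinM lee_fin; apply: bigmax_le => [|i _].
  by rewrite mulr_ge0 ?invr_ge0// sumr_ge0// => e _; exact: maxabs_ge0.
exact: (maxabs_le_signs (fun i j => X i j x)).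
Qed.

(** The value -oo is that of an empty supremum; allowing it spares exhibiting a member. *)
Lemma Eq_ge0 : (Eq n p q sigma B = -oo \/ 0 <= Eq n p q sigma B)%E.
Proof.
have [->|E0] := eqVneq (Eq n p q sigma B) -oo%E; [by left|right].
move: E0; rewrite -ltNye => /ereal_sup_gt[v Ev _]; apply: (@le_trans _ _ v).
  move: Ev => [d [T [P [X [_ [_ [_ [_ [_ ->]]]]]]]]].
  by apply: expectation_ge0 => x; exact: bigmax_ge_id.
exact: ereal_sup_ubound.
Qed.

Lemma Mq'_le_Mq : (Mq' n p q sigma B <= Mq n p q sigma B)%E.
Proof.
apply: ge_ereal_sup => _ [d [T [P [X [iX [XP ->]]]]]].
have mX i : measurable_rvec (X i) by have [] := XP i.
apply: (@le_trans _ _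
  ('E_P[fun x => (\big[Num.max/0]_(i < n) normInf (X i) x)%R])%E); last first.
  by apply: ereal_sup_ubound; exists d, T, P, X.
rewrite unlock; apply: ge0_le_integral => //.
- by move=> x _; rewrite lee_fin bigmax_ge_id.
- apply/measurable_EFinP; apply: measurable_bigmaxr => i.
  exact: (measurable_tail (tauq n p q sigma B) (mX i)).
- apply/measurable_EFinP; apply: measurable_bigmaxr => i.
  by apply: measurable_maxabs; exact: mX.
move=> x _; rewrite lee_fin; apply: le_bigmax2 => i _.
exact: (tail_le (tauq n p q sigma B) ((X i)^~ x)).
Qed.


(** Two unrelated mixtures are used: [Y], from [X], controls the tails, and [Y'], from the truncated
    [Z], controls the bounded part. Being members of their classes, they also give the signs of
    [Estar] and [Mq'], with which the constant 4 may be raised. *)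
Lemma Eq_member_le d (T : measurableType d) (P : probability T R)
    (X : 'I_n -> @rvec R d T p) (tau := tauq n p q sigma B) :
  (forall i, measurable_rvec (X i)) -> indep_rvecs P X -> (forall i, centered P (X i)) ->
  (Vn P X <= (sigma ^+ 2)%:E)%E -> (Dn P q X <= B%:E)%E ->
  [/\ (0 <= Estar n p q sigma B tau)%E, (0 <= Mq' n p q sigma B)%E &
   ((n%:R^-1)%:E * \int[P]_x (maxabs (fun j => (\sum_i X i j x)%R))%:E <=
    4%:E * (Estar n p q sigma B tau + (n%:R^-1)%:E * Mq' n p q sigma B))%E].
Proof.
move=> mX iX cX VX DX; have q0 : 0 < q by rewrite (lt_le_trans _ q1).
have c0 : (0 <= (n%:R^-1)%:E :> \bar R)%E by rewrite lee_fin invr_ge0.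
have VX' j : ((n%:R^-1)%:E * \sum_k \int[P]_x (X k j x ^+ 2)%:E <= (sigma ^+ 2)%:E)%E.
  apply: le_trans VX; rewrite /Vn expectation.unlock.
  exact: (le_bigmax_cond _ (fun j =>
    (n%:R^-1)%:E * \sum_(i < n) \int[P]_x (X i j x ^+ 2)%:E)%E).
have DX' : (((n%:R^-1)%:E * \sum_k \int[P]_x (normInf (X k) x `^ q)%:E) `^ q^-1 <= B%:E)%E.
  by move: DX; rewrite /Dn expectation.unlock.
have moment0 (W : 'I_n -> @rvec R d T p) :
    (0 <= (n%:R^-1)%:E * \sum_k \int[P]_x (normInf (W k) x `^ q)%:E)%E.
  apply: mule_ge0 => //; apply: sume_ge0 => k _.
  by apply: integral_ge0 => x _; rewrite lee_fin powR_ge0.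
have [d1 [T1 [P1 [Y [mY iidY lawY intY]]]]] := iid_mixture P n0 mX.
have YP i : in_Pq P1 q sigma B (Y i).
  by apply: mixture_in_Pq mX cX VX' DX' (mY i) _ => g mg g0; exact: intY.
have tauY i : (Tquant P1 n (Y i) <= tau)%E.
  by apply: ereal_sup_ubound; exists d1, T1, P1, (Y i).
have tau0 : (0 <= tau)%E by exact: le_trans (Tquant_ge0 _ _ _) (tauY (Ordinal n0)).
pose Z i := half_centered P tau (X i).
have mZ i : measurable_rvec (Z i) by exact: measurable_half_centered.
have cZ i : centered P (Z i) by exact: centered_half_centered.
have tv d0 (T0 : measurableType d0) (W : @rvec R d0 T0 p) x : tnth (vec W x) = W^~ x.
  by apply/funext => j; rewrite tnth_vec.
have mcoord : measurable_rvec (fun j (v : p.-tuple R) => tnth v j).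
  by move=> j; exact: measurable_tnth.
have iZ : indep_rvecs P Z.
  (* The mean subtracted is a constant for each [i], so [Z i] is a function of [X i] alone. *)
  pose phi i j (v : p.-tuple R) := 2^-1 * (low tau (tnth v) j - low_mean P tau (X i) j).
  have -> : Z = fun i j x => phi i j (vec (X i) x).
    by apply/funext => i; apply/funext => j; apply/funext => x; rewrite /phi tv.
  apply: indep_rvecs_comp => // i j; apply: measurable_funM => //.
  by apply: measurable_funB => //; exact: measurable_low mcoord j.
have [d2 [T2 [P2 [Y' [mY' iidY' lawY' intY']]]]] := iid_mixture P n0 mZ.
have Y'P i : in_Pqinf P2 q sigma B tau (Y' i).
  split.
    apply: (mixture_in_Pq mZ cZ _ _ (mY' i) _).
    - move=> j; apply: le_trans (VX' j); apply: lee_wpmul2l => //.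
      by apply: lee_sum => k _; exact: half_centered_sqr.
    - rewrite (poweR_inv_le q0 (moment0 Z) B0).
      rewrite (poweR_inv_le q0 (moment0 X) B0) in DX'.
      apply: le_trans DX'; apply: lee_wpmul2l => //.
      by apply: lee_sum => k _; exact: half_centered_powR.
    - by move=> g mg g0; exact: intY'.
  pose Bad := [set v : p.-tuple R | (tau < (maxabs (tnth v))%:E)%E].
  have mBad : measurable Bad.
    by rewrite -[X in measurable X]setTI; apply: (measurable_gt_tau tau mcoord).
  have -> : [set x | (tau < (normInf (Y' i) x)%:E)%E] = vec (Y' i) @^-1` Bad.
    by apply/seteqP; split => x; rewrite /Bad /= tv.
  rewrite lawY'// big1 ?mule0// => k _.
  rewrite (_ : _ @^-1` _ = set0) ?measure0//.
  apply/seteqP; split => x; rewrite /Bad /= ?tv //.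
  move=> /lt_le_trans/(_ (half_centered_tau (mX k) (cX k) x tau0)).
  by rewrite ltxx.
pose K := (\int[P2]_x (maxabs (fun j => (\sum_i Y' i j x)%R))%:E)%E.
have K0 : (0 <= K)%E by apply: integral_ge0 => x _; rewrite lee_fin maxabs_ge0.
have KE : ((n%:R^-1)%:E * K <= Estar n p q sigma B tau)%E.
  by rewrite -expectation_mean//; apply: ereal_sup_ubound; exists d2, T2, P2, Y'.
have ZK : (\int[P]_x (maxabs (fun j => (\sum_i Z i j x)%R))%:E <= 2%:E * K)%E.
  by apply: le_integral_maxabs_mixture => //; case: iidY'.
pose M := (\int[P1]_x (\big[Num.max/0%R]_i tail tau ((Y i)^~ x))%:E)%E.
have M0 : (0 <= M)%E by apply: integral_ge0 => x _; rewrite lee_fin bigmax_ge_id.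
have MM : (M <= Mq' n p q sigma B)%E.
  by apply: ereal_sup_ubound; exists d1, T1, P1, Y; rewrite expectation.unlock.
have tX0 k : (0 <= \int[P]_x (tail tau ((X k)^~ x))%:E)%E.
  by apply: integral_ge0 => x _; rewrite lee_fin tail_ge0.
have SM : (\sum_k \int[P]_x (tail tau ((X k)^~ x))%:E <= 2%:E * M)%E.
  have cY i : centered P1 (Y i) by have [_ []] := YP i.
  apply: le_trans (sum_integral_tail_le n0 mY (proj1 iidY) cY _); last first.
    by move=> i; apply: prob_gt_Tquant.
  (* Every [Y i] has the average of the mean tails of the [X k], so the [n] of them together recover
     the full sum. *)
  have YE i : (\int[P1]_x (tail tau ((Y i)^~ x))%:E =
      (n%:R^-1)%:E * \sum_k \int[P]_x (tail tau ((X k)^~ x))%:E)%E.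
    have := intY i (fun v => (tail tau (tnth v))%:E).
    under eq_integral do rewrite tv.
    move=> ->; last 2 first.
    - by apply/measurable_EFinP; exact: measurable_tail mcoord.
    - by move=> v; rewrite lee_fin tail_ge0.
    by congr (_ * _)%E; apply: eq_bigr => k _; apply: eq_integral => x _; rewrite tv.
  under [leRHS]eq_bigr do rewrite YE.
  rewrite -ge0_sume_distrl; last by move=> i _.
  rewrite sumEFin sumr_const card_ord -[X in (X%:E * _)%E]mulr_natl mulfV ?mul1e//.
  by rewrite pnatr_eq0 -lt0n.
split.
- by apply: le_trans KE; exact: mule_ge0.
- exact: le_trans MM.
have h := le_integral_maxabs_truncation tau mX cX.
exact: combine_bounds h ZK SM KE MM.
Qed.

End comparisons.

Local Open Scope ereal_scope.

Theorem theorem2p2 (R : realType) (n p : nat) (q sigma B : R) :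
  (1 <= q)%R -> (1 <= n)%N -> (1 <= p)%N -> (0 <= sigma)%R -> (0 <= B)%R ->
  [/\ (4%:R^-1)%:E * (Estar n p q sigma B (tauq n p q sigma B)
                        + (n%:R^-1)%:E * Mq n p q sigma B) <= Eq n p q sigma B,
      Eq n p q sigma B <= 128%:E * (Estar n p q sigma B (tauq n p q sigma B)
                        + (n%:R^-1)%:E * Mq n p q sigma B),
      (4%:R^-1)%:E * (Estar n p q sigma B (tauq n p q sigma B)
                        + (n%:R^-1)%:E * Mq' n p q sigma B) <= Eq n p q sigma B
    & Eq n p q sigma B <= 128%:E * (Estar n p q sigma B (tauq n p q sigma B)
                        + (n%:R^-1)%:E * Mq' n p q sigma B)].
Proof.
move=> q1 n0 _ _ B0; set tau := tauq n p q sigma B.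
have c0 : (0 <= (n%:R^-1)%:E :> \bar R)%E by rewrite lee_fin invr_ge0.
have EsE : (Estar n p q sigma B tau <= Eq n p q sigma B)%E by exact: Estar_le_Eq.
have MqE : ((n%:R^-1)%:E * Mq n p q sigma B <= Eq n p q sigma B)%E by exact: Mq_le_Eq.
have MM : (Mq' n p q sigma B <= Mq n p q sigma B)%E by exact: Mq'_le_Mq.
have cMM : ((n%:R^-1)%:E * Mq' n p q sigma B <= (n%:R^-1)%:E * Mq n p q sigma B)%E.
  exact: lee_wpmul2l.
have lower : ((4%:R^-1)%:E * (Estar n p q sigma B tau +
    (n%:R^-1)%:E * Mq n p q sigma B) <= Eq n p q sigma B)%E.
  apply: (@le_trans _ _ ((4%:R^-1)%:E * (Eq n p q sigma B + Eq n p q sigma B))%E).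
    by apply: lee_wpmul2l; [rewrite lee_fin invr_ge0|exact: leeD].
  (* In the empty case the left side is -oo as well. *)
  have [->|] := Eq_ge0 n p q sigma B.
    by rewrite mulrNy gtr0_sg ?invr_gt0// mul1e.
  case: (Eq n p q sigma B) => [r| |]; [|by move=> _; rewrite leey|by rewrite leeNy_eq].
  by rewrite -EFinD -EFinM !lee_fin => r0; lra.
have upper : (Eq n p q sigma B <= 128%:E * (Estar n p q sigma B tau +
    (n%:R^-1)%:E * Mq' n p q sigma B))%E.
  apply: ge_ereal_sup => _ [d [T [P [X [mX [iX [cX [VX [DX ->]]]]]]]]].
  have [E0 M0 h] := Eq_member_le q1 n0 B0 mX iX cX VX DX.
  rewrite expectation_mean//; apply: le_trans h _.
  apply: lee_wpmul2r; first by apply: adde_ge0 => //; exact: mule_ge0.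
  by rewrite lee_fin ler_nat.
(* Since [Mq'] is at most [Mq], the lower bound proved with [Mq] and the upper bound proved with
   [Mq'] imply the other two. *)
split=> //.
- apply: le_trans upper _; apply: lee_wpmul2l; first by rewrite lee_fin.
  exact: leeD.
- apply: le_trans lower; apply: lee_wpmul2l; first by rewrite lee_fin invr_ge0.
  exact: leeD.
Qed.
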